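(* Let $f:[0,\infty)\to\mathbb{R}$ be measurable and suppose that there exists $\epsilon_0>0$ such that $$\int_0^{4+\epsilon_0}\int_0^{4+\epsilon_0} F(x,y)\,\frac{1}{8\pi^2}\left(\frac{\sqrt{|(4-x)y|}}{\sqrt{|(4-y)x|}}+\frac{\sqrt{|(4-y)x|}}{\sqrt{|(4-x)y|}}\right)dx\,dy<\infty,\qquad F(x,y)=\left(\frac{f(x)-f(y)}{x-y}\right)^2 .$$ Then there exists a sequence of smooth functions $f^n$ in $L^\infty([0,4])$ which approximates $f$ in the $V_{\mathrm{LUE}}$ seminorm; i.e. given $\epsilon>0$ there exists $N$ such that $n>N$ implies $$V_{\mathrm{LUE}}[f-f^n]<\epsilon .$$
   Context: For a real-valued function $g$ on $[0,4]$, $$V_{\mathrm{LUE}}[g]=\int_0^4\int_0^4\left(\frac{g(x)-g(y)}{x-y}\right)^2\frac{4-(x-2)(y-2)}{4\pi^2\sqrt{4-(x-2)^2}\sqrt{4-(y-2)^2}}\,dx\,dy .$$ *)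

(* Defs.v *)
From HB Require Import structures.
From mathcomp Require Import all_boot all_order all_algebra.
From mathcomp Require Import all_classical all_reals all_analysis.

Set Implicit Arguments.
Unset Strict Implicit.
Unset Printing Implicit Defensive.

Import Order.TTheory GRing.Theory Num.Theory.
Import numFieldNormedType.Exports.

Local Open Scope classical_set_scope.
Local Open Scope ring_scope.

Section Definitions.
Variable R : realType.
Implicit Types (f g : R -> R) (x y : R).

(* Functions on [0, oo) or [0, 4] are represented by functions on R: the
   integrals below only involve their values on the domain of integration.
   Divisions by zero evaluate to 0; they occur only on the diagonal and when a
   coordinate is 0 or 4, hence on a null set. *)

Definition diffquot2 f x y : R := ((f x - f y) / (x - y)) ^+ 2.

Definition LUE_weight x y : R :=
  (4 - (x - 2) * (y - 2)) /
  (4 * pi ^+ 2 * Num.sqrt (4 - (x - 2) ^+ 2) * Num.sqrt (4 - (y - 2) ^+ 2)).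

(* Extended-real valued: +oo when the integral diverges. *)
Definition V_LUE g : \bar R :=
  (\int[lebesgue_measure]_(y in `[0%R, 4%R])
     \int[lebesgue_measure]_(x in `[0%R, 4%R])
       (diffquot2 g x y * LUE_weight x y)%:E)%E.

Definition hyp_weight x y : R :=
  1 / (8 * pi ^+ 2) *
  (Num.sqrt `|(4 - x) * y| / Num.sqrt `|(4 - y) * x| +
   Num.sqrt `|(4 - y) * x| / Num.sqrt `|(4 - x) * y|).

Definition hyp_integral (e : R) f : \bar R :=
  (\int[lebesgue_measure]_(y in `[0%R, (4 + e)%R])
     \int[lebesgue_measure]_(x in `[0%R, (4 + e)%R])
       (diffquot2 f x y * hyp_weight x y)%:E)%E.

Definition smooth g : Prop := forall (k : nat) x, derivable (derive1n k g) x 1.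

(* g belongs to L^oo([0, 4]), via the extension by 0 of its restriction. *)
Definition Linfty04 g : Prop :=
  (g \_ `[0, 4]) \in Lfun (@lebesgue_measure R) +oo%E.

End Definitions.

(* Main.v *)
Require Import Defs.
From HB Require Import structures.
From mathcomp Require Import all_boot all_order all_algebra.
From mathcomp Require Import all_classical all_reals all_analysis.
From mathcomp Require Import measurable_realfun ess_sup_inf ring lra.

(** With [x = 2 + 2 cos t] a function on [0, 4] becomes an even function [h] on
    the circle, and the LUE variance becomes, up to the factor [32 * pi ^+ 2],
    the energy
<<
    E(h) = int_t D_t(h) / sin^2 (t / 2),   D_t(h) = int_x (h(x) - h(x + t))^2,
>>
    over one period, which is the squared homogeneous Sobolev seminorm of order
    1/2 ([V_LUE_circle_energy], by the change of variables
    [integral_circle_map]). On [0, 4] the weight of the hypothesis equals the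
    LUE weight ([hyp_weightE]), so [h] has finite energy.

    Energy is well suited to convolution. Let [K >= 0] have mass 1 and let [g] be
    the convolution of [h] with [K]. By Jensen's inequality and translation
    invariance, [D_t(g) <= D_t(h)] for every [t] ([increment2_convolution]) and
    the squared norm of [h - g] is at most [int_s K(s) D_s(h)]
    ([sqnorm_sub_convolution]), hence at most [E(h)] times the supremum of
    [K(s) sin^2 (s / 2)] ([kernel_increment_le]). Along kernels for which this
    supremum tends to 0, the increments [D_t(h - g)], being at most 4 times the
    squared norm of [h - g], tend to 0 for each [t]; they are also dominated by
    [4 D_t(h)], so dominated convergence in the single variable [t] gives
    [E(h - g) -> 0] ([circle_energy_cvg0]).

    Normalised powers of [cos^2 (t / 2)] are such kernels
    ([cosine_power_kernel]). As they are polynomials in [cos t], and [h] is even,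
    the convolution is a polynomial in [cos t] ([convolution_horner_cos]), that
    is, a polynomial in [x]. So the approximants are polynomials, which are
    smooth, and bounded on [0, 4]. *)

Import Order.TTheory GRing.Theory Num.Theory.
Import numFieldNormedType.Exports.

Local Open Scope classical_set_scope.
Local Open Scope ring_scope.

Set Implicit Arguments.
Unset Strict Implicit.

(** * Iterated integrals over sets *)

Section tonelli_sets.
Context d1 d2 (T1 : measurableType d1) (T2 : measurableType d2) (R : realType).
Variable m1 : {sigma_finite_measure set T1 -> \bar R}.
Variable m2 : {sigma_finite_measure set T2 -> \bar R}.

Lemma tonelli_sets (A : set T1) (B : set T2) (f : T1 * T2 -> \bar R) :
  measurable A -> measurable B -> measurable_fun setT f ->
  (forall z, 0 <= f z)%E ->
  (\int[m1]_(x in A) \int[m2]_(y in B) f (x, y) =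
   \int[m2]_(y in B) \int[m1]_(x in A) f (x, y))%E.
Proof.
move=> mA mB mf f0.
pose g := f \_ (A `*` B).
have mg : measurable_fun setT g.
  apply/(measurable_restrictT _ (measurableX mA mB)).
  exact: measurable_funTS.
have g0 z : (0 <= g z)%E by rewrite /g patchE; case: ifP.
have := @fubini_tonelli _ _ _ _ _ m1 m2 g mg g0.
have gE x y : g (x, y) = (if x \in A then ((fun y => f (x, y)) \_ B) y else 0)%E.
  by rewrite /g !patchE in_setX; case: (x \in A).
have gE' x y : g (x, y) = (if y \in B then ((fun x => f (x, y)) \_ A) x else 0)%E.
  by rewrite /g !patchE in_setX/=; case: (x \in A); case: (y \in B).
have -> : (\int[m1]_x \int[m2]_y g (x, y) =
    \int[m1]_(x in A) \int[m2]_(y in B) f (x, y))%E.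
  rewrite [RHS]integral_mkcond; apply: eq_integral => x _.
  rewrite [RHS]patchE; case: ifPn => xA.
    rewrite [RHS]integral_mkcond; apply: eq_integral => y _.
    by rewrite gE xA.
  by rewrite integral0_eq// => y _; rewrite gE (negbTE xA).
move=> ->.
rewrite [RHS]integral_mkcond; apply: eq_integral => y _.
rewrite [RHS]patchE; case: ifPn => yB.
  rewrite [RHS]integral_mkcond; apply: eq_integral => x _.
  by rewrite gE' yB.
by rewrite integral0_eq// => x _; rewrite gE' (negbTE yB).
Qed.

Lemma measurable_integral_snd (B : set T2) (f : T1 * T2 -> \bar R) :
  measurable B -> measurable_fun setT f -> (forall z, 0 <= f z)%E ->
  measurable_fun setT (fun x => \int[m2]_(y in B) f (x, y))%E.
Proof.
move=> mB mf f0.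
pose g := f \_ (setT `*` B).
have mg : measurable_fun setT g.
  apply/(measurable_restrictT _ (measurableX measurableT mB)).
  exact: measurable_funTS.
have g0 z : (0 <= g z)%E by rewrite /g patchE; case: ifP.
have := @measurable_fun_fubini_tonelli_F _ _ _ _ _ m2 g mg g0.
congr (measurable_fun _ _); apply/funext => x; rewrite /fubini_F.
rewrite [RHS]integral_mkcond; apply: eq_integral => y _.
by rewrite /g !patchE in_setX in_setT.
Qed.

End tonelli_sets.

(** * Translations, reflections and periods *)

Section periods.
Context {R : realType}.
Local Notation mu := (@lebesgue_measure R).
Implicit Types (F : R -> \bar R) (a b s : R).

Lemma measurable_addr s :
  measurable_fun setT ((fun x => x + s) : measurableTypeR R -> measurableTypeR R).
Proof.
apply: (@continuous_measurable_fun R) => x.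
by apply: cvgD; [exact: cvg_id|exact: cvg_cst].
Qed.

Lemma lebesgue_measure_shift s (A : set R) : measurable A ->
  pushforward mu ((fun x => x + s) : _ -> measurableTypeR R) A = mu A.
Proof.
move=> mA; apply/esym/lebesgue_measure_unique => //=.
  exact: measurable_addr.
move=> _ _ [[a b]] _ <-; rewrite /pushforward.
rewrite (_ : _ @^-1` _ = `]a - s, b - s]%classic); last first.
  by apply/seteqP; split => x /=; rewrite !in_itv/= ltrBlDr lerBrDr.
rewrite !lebesgue_measure_itv/= !lte_fin ltrD2r -!EFinD.
by case: ifP => // _; congr (_%:E); ring.
Qed.

Lemma integral_shift s (A : set R) F : measurable A -> measurable_fun setT F ->
  (forall x, 0 <= F x)%E ->
  (\int[mu]_(x in A) F x =
   \int[mu]_(x in (fun x => x + s)%R @^-1` A) F (x + s)%R)%E.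
Proof.
move=> mA mF F0.
transitivity (\int[pushforward mu ((fun x => x + s)%R : R -> measurableTypeR R)]_(x in A)
    F x)%E.
  apply: eq_measure_integral => //=; [exact: measurable_addr|move=> mf B mB _].
  exact/esym/lebesgue_measure_shift.
rewrite ge0_integral_pushforward//.
- exact: measurable_addr.
- exact: measurable_funTS.
Qed.

Lemma integral_opp (A : set R) F : measurable A -> measurable_fun A F ->
  (forall x, 0 <= F x)%E ->
  (\int[mu]_(x in A) F x = \int[mu]_(x in -%R @^-1` A) F (- x)%R)%E.
Proof.
move=> mA mF F0.
transitivity (\int[pushforward mu (-%R%R : R -> measurableTypeR R)]_(x in A) F x)%E.
  by apply: eq_measure_integral => //= B mB _; exact/esym/lebesgue_measureN.
by rewrite ge0_integral_pushforward.
Qed.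

Lemma preimage_shift_itv s a b c d :
  ((fun x : R => x + s) @^-1` [set` Interval (BSide c a) (BSide d b)]) =
  [set` Interval (BSide c (a - s)) (BSide d (b - s))].
Proof.
by apply/seteqP; split => x /=; case: c; case: d; rewrite !in_itv/=
  ?lerBlDr ?ltrBlDr ?lerBrDr ?ltrBrDr.
Qed.

Lemma integral_itv_split a b c F : measurable_fun setT F ->
  (forall x, 0 <= F x)%E -> a <= c <= b ->
  (\int[mu]_(x in `[a, b]) F x =
   \int[mu]_(x in `[a, c]) F x + \int[mu]_(x in `[c, b]) F x)%E.
Proof.
move=> mF F0 /andP[ac cb].
have mFA (A : set R) : measurable_fun A F by exact: measurable_funTS.
rewrite (@itv_bndbnd_setU _ _ _ (BRight c)) ?bnd_simp//.
rewrite ge0_integral_setU//; [|exact: mFA|]; last first.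
  apply/disj_setPLR => x/=; rewrite !in_itv/= => /andP[_ h] /andP[].
  by rewrite ltNge h.
by congr (_ + _)%E; rewrite integral_itv_obnd_cbnd//; exact: mFA.
Qed.

Lemma integral_shift_itv s a b F : measurable_fun setT F ->
  (forall x, 0 <= F x)%E ->
  (\int[mu]_(x in `[a, b]) F (x + s)%R =
   \int[mu]_(x in `[(a + s)%R, (b + s)%R]) F x)%E.
Proof.
move=> mF F0; rewrite [RHS](integral_shift s)//.
by rewrite preimage_shift_itv !addrK.
Qed.

Local Notation P := (`[- pi, pi]%classic : set R).

(** The part of the shifted period beyond [pi] is moved back by one period. *)
Lemma integral_period_shift_pos s F : measurable_fun setT F ->
  (forall x, 0 <= F x)%E -> (forall x, F (x + pi *+ 2) = F x) ->
  0 <= s <= pi *+ 2 ->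
  (\int[mu]_(x in P) F (x + s)%R = \int[mu]_(x in P) F x)%E.
Proof.
move=> mF F0 perF /andP[s0 s2].
have pi0 := @pi_gt0 R.
have s2' : s <= pi + pi by rewrite -mulr2n.
rewrite integral_shift_itv// (@integral_itv_split _ _ pi)//; last by lra.
rewrite addeC.
have -> : (\int[mu]_(x in `[pi, (pi + s)%R]) F x =
    \int[mu]_(x in `[(- pi)%R, (- pi + s)%R]) F x)%E.
  transitivity (\int[mu]_(x in `[(- pi)%R, (- pi + s)%R]) F (x + pi *+ 2)%R)%E.
    rewrite integral_shift_itv// (_ : - pi + pi *+ 2 = pi); last by ring.
    by rewrite (_ : - pi + s + pi *+ 2 = pi + s)//; ring.
  by apply: eq_integral => x _; rewrite perF.
by rewrite -integral_itv_split//; lra.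
Qed.

Lemma integral_period_shift s F : measurable_fun setT F ->
  (forall x, 0 <= F x)%E -> (forall x, F (x + pi *+ 2) = F x) ->
  `|s| <= pi *+ 2 ->
  (\int[mu]_(x in P) F (x + s)%R = \int[mu]_(x in P) F x)%E.
Proof.
move=> mF F0 perF; have [s0|s0] := leP 0 s.
  by rewrite ger0_norm// => ?; apply: integral_period_shift_pos => //; apply/andP.
rewrite ltr0_norm// => s2.
rewrite -(@integral_period_shift_pos (- s) (fun x => F (x + s)))//=.
- by apply: eq_integral => x _; rewrite subrK.
- by apply: measurableT_comp => //; exact: measurable_addr.
- by move=> x; rewrite addrAC perF.
- by rewrite oppr_ge0 ltW.
Qed.

Lemma period_norm_le t : P t -> `|t| <= pi *+ 2.
Proof.
rewrite /= in_itv/= ler_norml mulr2n; have := @pi_gt0 R => pi0 /andP[? ?].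
by apply/andP; split; lra.
Qed.

Lemma period_normD_le s t : P s -> P t -> `|s + t| <= pi *+ 2.
Proof.
rewrite /= !in_itv/= ler_norml mulr2n => /andP[? ?] /andP[? ?].
by apply/andP; split; lra.
Qed.

Lemma integral_fold F : measurable_fun setT F -> (forall x, 0 <= F x)%E ->
  (\int[mu]_(x in P) F x = \int[mu]_(x in `[0%R, pi]) (F x + F (- x)%R))%E.
Proof.
move=> mF F0; have pi0 := @pi_gt0 R.
have mFA (A : set R) : measurable_fun A F by exact: measurable_funTS.
rewrite (@integral_itv_split _ _ 0)//; last by lra.
have mFN : measurable_fun [set: measurableTypeR R] (fun x => F (- x)).
  by apply: measurableT_comp.
rewrite ge0_integralD//; first last; [exact: measurable_funTS|exact: mFA|].
rewrite addeC; congr (_ + _)%E.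
by rewrite [LHS]integral_opp// opp_preimage_itvbndbnd/= opprK oppr0.
Qed.

End periods.

(** * Measures with a density *)

Section density.
Local Open Scope ereal_scope.
Context d (T : measurableType d) (R : realType).
Variables (mu : {measure set T -> \bar R}) (g : T -> R).
Hypotheses (mg : measurable_fun setT g) (g0 : forall x, (0 <= g x)%R).

Definition density (A : set T) := \int[mu]_(x in A) (g x)%:E.

Let density0 : density set0 = 0.
Proof. exact: integral_set0. Qed.

Let density_ge0 A : 0 <= density A.
Proof. by apply: integral_ge0 => x _; rewrite lee_fin. Qed.

Let mgE : measurable_fun setT (EFin \o g).
Proof. exact/measurable_EFinP. Qed.

Let density_sigma_additive : semi_sigma_additive density.
Proof.
by apply: semi_sigma_additive_nng_induced => // x; rewrite lee_fin.
Qed.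

HB.instance Definition _ := isMeasure.Build _ _ _
  density density0 density_ge0 density_sigma_additive.

(** [density] bundled with its measure structure, whose construction needs the
    two hypotheses on [g]. *)
Definition density_measure : {measure set T -> \bar R}.
Proof. exact: (Measure.clone _ _ _ density _). Defined.

Import HBNNSimple.

Lemma ge0_integral_density (D : set T) (f : T -> \bar R) : measurable D ->
  measurable_fun D f -> (forall x, 0 <= f x) ->
  \int[density_measure]_(x in D) f x = \int[mu]_(x in D) (f x * (g x)%:E).
Proof.
move=> mD mf f0; pose h := nnsfun_approx mD mf.
have hge n x : 0 <= (h n x)%:E by rewrite lee_fin.
have mh n : measurable_fun D (fun x => (h n x)%:E).
  by apply/measurable_EFinP/measurable_funTS.
have mgD : measurable_fun D (fun x => (g x)%:E) by exact: measurable_funTS.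
have hnd x : D x -> {homo (fun n => (h n x)%:E) : n m / (n <= m)%N >-> n <= m}.
  by move=> Dx m n mn; rewrite lee_fin; exact/lefP/nd_nnsfun_approx.
transitivity (limn (fun n => \int[density_measure]_(x in D) (h n x)%:E)).
  rewrite -monotone_convergence//=.
  by apply: eq_integral => x /[!inE] xD; apply/esym/cvg_lim => //;
    exact: cvg_nnsfun_approx.
transitivity (limn (fun n => \int[mu]_(x in D) ((h n x)%:E * (g x)%:E))).
  congr (limn _); apply/funext => n.
  have hE x : (h n x)%:E = \sum_(y \in range (h n))
      (y * \1_(h n @^-1` [set y]) x)%:E by rewrite fimfunE -fsumEFin.
  have mind r : measurable_fun D (fun x => (r * \1_(h n @^-1` [set r]) x)%:E).
    by apply: (measurable_comp measurableT) => //; exact: measurable_funM.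
  under [LHS]eq_integral do rewrite hE.
  rewrite ge0_integral_fsum//; last by move=> r x _; exact: nnfun_muleindic_ge0.
  under [RHS]eq_integral => x xD.
    rewrite hE ge0_mule_fsuml; last by move=> r; exact: nnfun_muleindic_ge0.
    over.
  rewrite ge0_integral_fsum//; last 2 first.
  - by move=> r; exact: emeasurable_funM.
  - move=> r x _; apply: mule_ge0; last by rewrite lee_fin.
    exact: nnfun_muleindic_ge0.
  apply: eq_fsbigr => r rhn.
  under [LHS]eq_integral do rewrite EFinM.
  rewrite integralZl_indic_nnsfun => //.
  under [RHS]eq_integral do rewrite EFinM -muleA.
  have mI : measurable (h n @^-1` [set r]) by [].
  have [r0|r0] := ltP r 0%R.
    rewrite preimage_nnfun0// !integral0_eq ?mule0//.
      by move=> x _; rewrite indic0 mul0e mule0.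
    by move=> x _; rewrite indic0.
  rewrite ge0_integralZl_EFin//; last first.
  - by apply: emeasurable_funM => //; exact/measurable_EFinP.
  - by move=> x _; rewrite mule_ge0// lee_fin.
  congr (_ * _); rewrite integral_indic// setIC.
  transitivity (\int[mu]_(x in D `&` h n @^-1` [set r]) (g x)%:E) => //.
  rewrite integral_mkcondr.
  by apply: eq_integral => x xD; rewrite epatch_indic muleC.
rewrite -monotone_convergence//=.
- apply: eq_integral => x /[!inE] xD; apply/cvg_lim => //.
  by apply: cvgeZr => //; exact: cvg_nnsfun_approx.
- by move=> n; exact: emeasurable_funM.
- by move=> n x xD; rewrite mule_ge0 ?lee_fin.
- by move=> x xD m n mn; rewrite lee_wpmul2r ?lee_fin//; exact/lefP/nd_nnsfun_approx.
Qed.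

End density.
Arguments density_measure {d T R}.

(** * The substitution by 2 + 2 cos t *)

Section circle_substitution.
Context {R : realType}.
Local Notation mu := (@lebesgue_measure R).

Definition circle_map (t : R) : R := 2 + 2 * cos t.

Lemma continuous_circle_map : continuous circle_map.
Proof.
move=> x; apply: cvgD; first exact: cvg_cst.
by apply: cvgM; [exact: cvg_cst|exact: continuous_cos].
Qed.

Lemma measurable_circle_map : measurable_fun setT circle_map.
Proof. by apply: continuous_measurable_fun; exact: continuous_circle_map. Qed.

Lemma circle_map_itv t : 0 <= circle_map t <= 4.
Proof.
rewrite /circle_map; have := cos_le1 t; have := cos_geN1 t.
by move=> ? ?; apply/andP; split; lra.
Qed.

(** The absolute value of the derivative of [circle_map], cut off to an arc on
    which [circle_map] is injective. *)
Definition arc_density (t : R) : R := 2 * `|sin t| * \1_(`[0, pi]%classic : set R) t.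

Lemma measurable_arc_density : measurable_fun setT arc_density.
Proof.
apply: measurable_funM; last exact: measurable_indic.
apply: measurable_funM => //; apply: measurableT_comp => //.
by apply: continuous_measurable_fun; exact: continuous_sin.
Qed.

Lemma arc_density_ge0 t : 0 <= arc_density t.
Proof. by rewrite /arc_density !mulr_ge0// indicE ler0n. Qed.

Lemma integral_arc_density_itv (a b : R) : 0 <= a -> a <= b -> b <= pi ->
  (\int[mu]_(t in `[a, b]) (arc_density t)%:E = (circle_map a - circle_map b)%:E)%E.
Proof.
move=> a0; rewrite le_eqVlt => /predU1P[<- _|ab bpi].
  by rewrite set_itv1 integral_set1 subrr.
transitivity (\int[mu]_(t in `[a, b]) (2 * sin t)%:E)%E.
  apply: eq_integral => t; rewrite inE/= in_itv/= => /andP[at_ tb].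
  rewrite /arc_density indicE mem_set ?mulr1; last first.
    by rewrite /= in_itv/=; apply/andP; split; lra.
  by rewrite ger0_norm// sin_ge0_pi//; apply/andP; split; lra.
have dF (x : R) : is_derive x 1 (fun t : R => - (2 * cos t)) (2 * sin x).
  apply: is_derive_eq; rewrite /GRing.scale/=; ring.
rewrite (@continuous_FTC2 _ _ (fun t => - (2 * cos t)))//.
- by rewrite /circle_map -EFinD; congr (_%:E); ring.
- apply: continuous_subspaceT => x.
  by apply: cvgM; [exact: cvg_cst|exact: continuous_sin].
- have cF : continuous (fun t : R => - (2 * cos t)).
    move=> x; apply: cvgN; apply: cvgM; [exact: cvg_cst|exact: continuous_cos].
  split; first by move=> x _; exact: ex_derive.
    by apply: cvg_at_right_filter; exact: cF.
  by apply: cvg_at_left_filter; exact: cF.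
- by move=> x _; rewrite derive1E derive_val.
Qed.

(** Stated for any [S] squeezed between the preimages of the open and of the
    closed interval, so that the endpoints of the generating half-open
    intervals need no case analysis. *)
Lemma arc_preimage_squeeze (u v : R) (S : set R) :
  0 <= u -> u <= v -> v <= 4 -> measurable S ->
  (forall t, S t -> 0 <= t <= pi -> u <= circle_map t <= v) ->
  (forall t : R, 0 <= t <= pi -> u < circle_map t < v -> S t) ->
  (\int[mu]_(t in S) (arc_density t)%:E = (v - u)%:E)%E.
Proof.
move=> u0 uv v4 mS Suv uvS.
have itv1 (x : R) : 0 <= x <= 4 -> -1 <= (x - 2) / 2 <= 1.
  by move=> /andP[? ?]; apply/andP; split; lra.
have u14 : 0 <= u <= 4 by apply/andP; split; lra.
have v14 : 0 <= v <= 4 by apply/andP; split; lra.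
pose A x : R := acos ((x - 2) / 2).
have A0 (x : R) : 0 <= x <= 4 -> 0 <= A x <= pi.
  by move=> /itv1 x1; rewrite /A acos_ge0// acos_lepi.
have AK (x : R) : 0 <= x <= 4 -> circle_map (A x) = x.
  by move=> /itv1 x1; rewrite /circle_map /A acosK ?in_itv//=; field.
have Tlt (s t : R) : 0 <= s <= pi -> 0 <= t <= pi ->
    (circle_map t < circle_map s) = (s < t).
  move=> s0 t0; rewrite -(@ltr_cos _ s t) ?in_itv//= /circle_map.
  by rewrite ltrD2l ltr_pM2l.
have [/andP[Au0 Aup] /andP[Av0 Avp]] := (A0 _ u14, A0 _ v14).
have Avu : A v <= A u by rewrite leNgt -Tlt ?AK ?A0// -leNgt.
have pi0 := @pi_gt0 R.
have mg (B : set R) : measurable_fun B (EFin \o (@arc_density)).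
  by apply: measurable_funTS; apply/measurable_EFinP; exact: measurable_arc_density.
have g0 x : (0 <= (arc_density x)%:E)%E by rewrite lee_fin arc_density_ge0.
have -> : (\int[mu]_(t in S) (arc_density t)%:E =
    \int[mu]_(t in S `&` `[0%R, pi]) (arc_density t)%:E)%E.
  rewrite [RHS]integral_mkcondr; apply: eq_integral => t _.
  rewrite patchE; case: ifPn => // /negP; rewrite inE/= => tpi.
  by rewrite /arc_density indicE memNset// mulr0.
have mSp : measurable (S `&` `[0%R, pi]) by exact: measurableI.
rewrite -[in RHS](AK v)// -[in RHS](AK u)// -integral_arc_density_itv//.
apply/eqP; rewrite eq_le; apply/andP; split.
  apply: ge0_subset_integral => //; first exact: mg.
  move=> t [/Suv Tuv]; rewrite /= !in_itv/= => t0; move: (Tuv t0) => /andP[ut tv].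
  rewrite !leNgt; apply/andP; split; apply/negP => h.
    by move: h; rewrite -Tlt ?A0// AK// ltNge tv.
  by move: h; rewrite -Tlt ?A0// AK// ltNge ut.
rewrite (@integral_itv_bndoo _ _ _ _ true false)//.
apply: ge0_subset_integral => //; first exact: mg.
move=> t/=; rewrite !in_itv/= => /andP[vt tu].
have t0 : 0 <= t <= pi by apply/andP; split; lra.
split => //; apply: uvS => //.
by rewrite -{1}(AK u)// -{1}(AK v)// !Tlt ?A0//; apply/andP.
Qed.

(** The image under [circle_map] of the measure with density [arc_density]; it
    is Lebesgue measure on [0, 4]. *)
Definition arc_image_measure : {measure set (measurableTypeR R) -> \bar R}.
Proof.
refine (Measure.clone _ _ _ (pushforward
  (density_measure mu arc_density measurable_arc_density arc_density_ge0)
  (circle_map : R -> measurableTypeR R)) _).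
exact: measurable_circle_map.
Defined.

Local Notation nu := arc_image_measure.

Let nuE (A : set R) :
  nu A = (\int[mu]_(t in circle_map @^-1` A) (arc_density t)%:E)%E.
Proof. by []. Qed.

Let m4 : measurable (~` `[0%R, 4%R] : set (measurableTypeR R)).
Proof. exact: measurableC. Qed.

Let nu_itv (a b : R) : nu `]a, b]%classic = mu (`]a, b] `&` `[0%R, 4%R])%classic.
Proof.
rewrite nuE; pose u := Num.max a 0; pose v := Num.min b 4.
have [uv|vu] := leP u v; last first.
  have h x : (`]a, b] `&` `[0, 4])%classic x -> False.
    move=> [/=]; rewrite !in_itv/= => /andP[ax xb] /andP[x0 x4].
    suff : u <= v by rewrite leNgt vu.
    by apply: (@le_trans _ _ x); rewrite /u /v ?ge_max ?le_min ?xb ?x4 ?x0 ?ltW.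
  rewrite (_ : _ `&` _ = set0); last by apply/seteqP; split => x // /h.
  rewrite measure0 (_ : _ @^-1` _ = set0) ?integral_set0//.
  apply/seteqP; split => // t Tt; apply: (h (circle_map t)); split => //.
  by rewrite /= in_itv/= circle_map_itv.
have u0 : 0 <= u by rewrite /u le_max lexx orbT.
have v4 : v <= 4 by rewrite /v ge_min lexx orbT.
have mT : measurable (circle_map @^-1` `]a, b]).
  by rewrite -[X in measurable X]setTI; exact: measurable_circle_map.
rewrite (@arc_preimage_squeeze u v)//; last 2 first.
- move=> t /=; rewrite in_itv/= => /andP[aT Tb] _.
  have /andP[T0 T4] := circle_map_itv t.
  by rewrite /u /v ge_max le_min T0 T4 Tb ltW.
- move=> t _ /andP[uT Tv] /=; rewrite in_itv/=.
  rewrite (le_lt_trans _ uT) ?(le_trans (ltW Tv))// /u /v ?le_max ?ge_min ?lexx//.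
have mab : measurable (`]a, b] `&` `[0%R, 4%R] : set R) by exact: measurableI.
apply/eqP; rewrite eq_le; apply/andP; split.
  have -> : (v - u)%:E = mu `]u, v[%classic.
    rewrite lebesgue_measure_itv/= lte_fin; case: ltP => // vu.
    by rewrite (le_anti (introT andP (conj uv vu))) subrr.
  apply: le_measure; rewrite ?inE//.
  move=> x; rewrite /= !in_itv/= => /andP[]; rewrite /u /v gt_max lt_min.
  by move=> /andP[-> /ltW ->] /andP[/ltW -> /ltW ->].
have -> : (v - u)%:E = mu `[u, v]%classic.
  rewrite lebesgue_measure_itv/= lte_fin; case: ltP => // vu.
  by rewrite (le_anti (introT andP (conj uv vu))) subrr.
apply: le_measure; rewrite ?inE//.
move=> x; rewrite /= !in_itv/= => -[/andP[ax xb] /andP[x0 x4]].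
by rewrite /u /v ge_max le_min ltW// x0 xb x4.
Qed.

Let mu_nu (A : set R) : measurable A -> A `<=` `[0%R, 4%R] -> mu A = nu A.
Proof.
move=> mA A4.
have hE (B : set (measurableTypeR R)) :
    (measure_add nu (mrestr mu m4) B = nu B + mu (B `&` ~` `[0%R, 4%R]))%E.
  by rewrite measure_addE.
(* Lebesgue measure off [0, 4] is added so that the uniqueness theorem applies
   on the whole line. *)
have : mu A = measure_add nu (mrestr mu m4) A.
  apply: lebesgue_measure_unique => // _ [[a b] _ <-].
  transitivity (nu `]a, b]%classic + mu (`]a, b] `&` ~` `[0%R, 4%R]))%E.
    by rewrite nu_itv -setDE addeC -measureDI.
  exact/esym/hE.
rewrite hE => ->; rewrite (_ : A `&` _ = set0) ?measure0 ?adde0//.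
by apply/seteqP; split => x // [/A4].
Qed.

(** Lebesgue measure on [0, 4] is the image of a density on [0, pi]. This is an
    equality of measures, checked on intervals, so the substitution holds for
    every nonnegative measurable integrand, continuous or not. *)
Lemma integral_circle_map (F : R -> \bar R) : measurable_fun setT F ->
  (forall x, 0 <= F x)%E ->
  (\int[mu]_(x in `[0%R, 4%R]) F x =
   \int[mu]_(t in `[0%R, pi]) (F (circle_map t) * (2 * `|sin t|)%:E))%E.
Proof.
move=> mF F0.
transitivity (\int[nu]_(x in `[0%R, 4%R]) F x)%E.
  by apply: eq_measure_integral => A mA A4; exact: mu_nu.
transitivity (\int[pushforward (density_measure mu arc_density
    measurable_arc_density arc_density_ge0)
    (circle_map : R -> measurableTypeR R)]_(x in `[0%R, 4%R]) F x)%E.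
  by [].
rewrite ge0_integral_pushforward//; last 2 first.
- exact: measurable_circle_map.
- exact: measurable_funTS.
rewrite (_ : _ @^-1` _ = setT); last first.
  by apply/seteqP; split => t // _; rewrite /= in_itv/= circle_map_itv.
rewrite ge0_integral_density//; last 2 first.
- by apply: measurableT_comp => //; exact: measurable_circle_map.
- by move=> x; exact: F0.
rewrite [RHS]integral_mkcond; apply: eq_integral => t _.
rewrite patchE; case: ifPn => [|/negP]; rewrite inE/= => tpi.
  by rewrite /arc_density indicE mem_set// mulr1.
by rewrite /arc_density indicE memNset// mulr0 mule0.
Qed.

End circle_substitution.

(** * Jensen's inequality for squares *)

Section weighted_mean.
Context d (T : measurableType d) (R : realType).
Variables (mu : {measure set T -> \bar R}) (D : set T).
Hypotheses (mD : measurable D) (muD : (mu D < +oo)%E).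
Implicit Types u K : T -> R.

Lemma bounded_integrable K (B : R) : measurable_fun setT K ->
  (forall x, `|K x| <= B) -> mu.-integrable D (EFin \o K).
Proof.
move=> mK KB; apply: measurable_bounded_integrable => //.
  exact: measurable_funTS.
exists B; split; first exact: num_real.
by move=> x Bx y _ /=; rewrite (le_trans (KB y))// ltW.
Qed.

Lemma sqr_integrable u : measurable_fun setT u ->
  (\int[mu]_(x in D) (u x ^+ 2)%:E < +oo)%E ->
  mu.-integrable D (EFin \o (fun x => u x ^+ 2)).
Proof.
move=> mf fi; apply/integrableP; split.
  by apply/measurable_EFinP/measurable_funTS; exact: measurable_funX.
by under eq_integral do rewrite /= ger0_norm ?sqr_ge0//.
Qed.

Lemma sqr_integrable_integrable u : measurable_fun setT u ->
  (\int[mu]_(x in D) (u x ^+ 2)%:E < +oo)%E ->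
  mu.-integrable D (EFin \o u).
Proof.
move=> mf fi.
apply: (le_integrable mD (g := EFin \o (fun x => 1 + u x ^+ 2))).
- by apply/measurable_EFinP/measurable_funTS.
- move=> x _ /=; rewrite lee_fin [leRHS]ger0_norm ?addr_ge0 ?sqr_ge0//.
  rewrite -(real_normK (num_real (u x))).
  have := sqr_ge0 (`|u x| - 1); have := normr_ge0 (u x); nra.
- have -> : EFin \o (fun x => 1 + u x ^+ 2) =
      (cst 1%:E \+ (EFin \o (fun x => u x ^+ 2)%R))%E by [].
  apply: integrableD => //; last exact: sqr_integrable.
  apply: (@bounded_integrable (cst 1) 1) => // x.
  by rewrite /= normr1.
Qed.

Lemma bounded_integrableM K u (B : R) : measurable_fun setT K ->
  (forall x, `|K x| <= B) -> mu.-integrable D (EFin \o u) ->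
  mu.-integrable D (EFin \o (fun x => K x * u x)).
Proof.
move=> mK KB iu.
have -> : EFin \o (fun x => K x * u x) = ((EFin \o K) \* (EFin \o u))%E by [].
apply: integrableMr => //; first exact: measurable_funTS.
exists B; split; first exact: num_real.
by move=> x Bx y _ /=; rewrite (le_trans (KB y))// ltW.
Qed.

Variables (K : T -> R) (B : R).
Hypotheses (mK : measurable_fun setT K) (K0 : forall x, 0 <= K x)
  (KB : forall x, K x <= B) (K1 : (\int[mu]_(x in D) K x = 1)%R).

Let KB' x : `|K x| <= B. Proof. by rewrite ger0_norm. Qed.

(** Expand the integral of [K x * (u x - m) ^+ 2 >= 0], with [m] the weighted
    mean of [u]. *)
Lemma jensen_sqr u : measurable_fun setT u ->
  (\int[mu]_(x in D) (u x ^+ 2)%:E < +oo)%E ->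
  (((\int[mu]_(x in D) (K x * u x))%R ^+ 2)%:E <=
   \int[mu]_(x in D) (K x * u x ^+ 2)%:E)%E.
Proof.
move=> mu_ ui; set m := (\int[mu]_(x in D) (K x * u x))%R.
have iK : mu.-integrable D (EFin \o K).
  exact: bounded_integrable KB'.
have iKu : mu.-integrable D (EFin \o (fun x => K x * u x)).
  by apply: (bounded_integrableM (B := B)) => //; exact: sqr_integrable_integrable.
have iKu2 : mu.-integrable D (EFin \o (fun x => K x * u x ^+ 2)).
  by apply: (bounded_integrableM (B := B)) => //; exact: sqr_integrable.
have iKum : mu.-integrable D (EFin \o (fun x => (2 * m) * (K x * u x))).
  have := integrableZl mD (2 * m) iKu.
  by congr (integrable _ _ _); apply/funext => x.
have iKm : mu.-integrable D (EFin \o (fun x => m ^+ 2 * K x)).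
  have := integrableZl mD (m ^+ 2) iK.
  by congr (integrable _ _ _); apply/funext => x.
have iKB : mu.-integrable D
    (EFin \o (fun x => K x * u x ^+ 2 - (2 * m) * (K x * u x))).
  have := integrableB mD iKu2 iKum.
  by congr (integrable _ _ _); apply/funext => x.
have : 0 <= (\int[mu]_(x in D) (K x * (u x - m) ^+ 2))%R.
  by apply: Rintegral_ge0 => x _; rewrite mulr_ge0// sqr_ge0.
under eq_Rintegral => x _.
  rewrite (_ : _ * _ = (K x * u x ^+ 2 - (2 * m) * (K x * u x)) + m ^+ 2 * K x).
    over.
  ring.
rewrite RintegralD// RintegralB// !RintegralZl// K1 -/m => m0.
rewrite -[leRHS]fineK ?lee_fin; last exact: integrable_fin_num.
by have : m ^+ 2 <= (\int[mu]_(x in D) (K x * u x ^+ 2))%R by nra.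
Qed.

End weighted_mean.

(** * Increments in quadratic mean *)

Section circle_increments.
Context {R : realType}.
Local Notation mu := (@lebesgue_measure R).
Local Notation P := (`[- pi, pi]%classic : set R).
Local Notation RR := (measurableTypeR R * measurableTypeR R)%type.
Implicit Types (h g u v K : R -> R) (s t x : R).

Definition sqnorm u : \bar R := (\int[mu]_(x in P) (u x ^+ 2)%:E)%E.

Definition translate s u x := u (x + s).

Definition increment2 u t : \bar R := sqnorm (fun x => u x - u (x + t)).

Lemma pi2_gt0 : 0 < pi *+ 2 :> R.
Proof. by rewrite mulrn_wgt0// pi_gt0. Qed.

Lemma lebesgue_measure_period : mu P = (pi *+ 2)%:E.
Proof.
rewrite lebesgue_measure_itv/= lte_fin gtrN ?pi_gt0//.
by rewrite -EFinD opprK mulr2n.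
Qed.

Lemma period_lty : (mu P < +oo)%E.
Proof. by rewrite lebesgue_measure_period ltry. Qed.

Lemma sqnorm_ge0 u : (0 <= sqnorm u)%E.
Proof. by apply: integral_ge0 => x _; rewrite lee_fin sqr_ge0. Qed.

Lemma measurable_translate s u : measurable_fun setT u ->
  measurable_fun setT (translate s u).
Proof. by move=> mu_; apply: measurableT_comp => //; exact: measurable_addr. Qed.

Lemma measurable_sqr u : measurable_fun setT u ->
  measurable_fun setT (fun x => (u x ^+ 2)%:E).
Proof. by move=> mu_; apply/measurable_EFinP; exact: measurable_funX. Qed.

Lemma sqnorm_translate s u : measurable_fun setT u ->
  (forall x, u (x + pi *+ 2) = u x) -> `|s| <= pi *+ 2 ->
  sqnorm (translate s u) = sqnorm u.
Proof.
move=> mu_ peru s2.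
rewrite /sqnorm -[RHS](@integral_period_shift _ s)//.
- exact: measurable_sqr.
- by move=> x; rewrite lee_fin sqr_ge0.
- by move=> x; rewrite peru.
Qed.

Lemma sqnormB u v : measurable_fun setT u -> measurable_fun setT v ->
  (sqnorm (u \- v)%R <= 2%:E * sqnorm u + 2%:E * sqnorm v)%E.
Proof.
move=> mu_ mv; rewrite /sqnorm.
have sq0 (w : R -> R) x : (0 <= (w x ^+ 2)%:E)%E by rewrite lee_fin sqr_ge0.
have mu2 := measurable_funTS (measurable_sqr mu_) : measurable_fun P _.
have mv2 := measurable_funTS (measurable_sqr mv) : measurable_fun P _.
rewrite -!ge0_integralZl//= -ge0_integralD//; first last.
- by apply: measurable_funeM.
- by move=> x _; rewrite mule_ge0.
- by apply: measurable_funeM.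
- by move=> x _; rewrite mule_ge0.
apply: ge0_le_integral => //.
- by apply: measurable_funTS; apply: measurable_sqr; exact: measurable_funB.
- by apply: emeasurable_funD; apply: measurable_funeM.
- move=> x _; rewrite -!EFinM -EFinD lee_fin.
  have := sqr_ge0 (u x + v x); nra.
Qed.

Lemma increment2B u v t : measurable_fun setT u -> measurable_fun setT v ->
  (increment2 (u \- v)%R t <= 2%:E * increment2 u t + 2%:E * increment2 v t)%E.
Proof.
move=> mu_ mv; rewrite /increment2.
have mB (w : R -> R) : measurable_fun setT w ->
    measurable_fun setT (fun x => w x - w (x + t)).
  by move=> mw; apply: measurable_funB => //; exact: measurable_translate.
apply: le_trans (sqnormB (mB _ mu_) (mB _ mv)).
rewrite le_eqVlt; apply/orP; left; apply/eqP; congr sqnorm.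
by apply/funext => x /=; ring.
Qed.

Lemma increment2_le_sqnorm u t : measurable_fun setT u ->
  (forall x, u (x + pi *+ 2) = u x) -> `|t| <= pi *+ 2 ->
  (increment2 u t <= 4%:E * sqnorm u)%E.
Proof.
move=> mu_ peru t2.
apply: le_trans (sqnormB mu_ (measurable_translate t mu_)) _.
rewrite sqnorm_translate// -ge0_muleDl ?lee_fin// -EFinD.
by rewrite (_ : 2 + 2 = 4 :> R)//; ring.
Qed.

Lemma increment2_translate s u t : measurable_fun setT u ->
  (forall x, u (x + pi *+ 2) = u x) -> `|s| <= pi *+ 2 ->
  increment2 (translate s u) t = increment2 u t.
Proof.
move=> mu_ peru s2; rewrite /increment2 -[RHS](@sqnorm_translate s)//.
- by congr sqnorm; apply/funext => x; rewrite /translate addrAC.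
- by apply: measurable_funB => //; exact: measurable_translate.
- by move=> x; rewrite addrAC !peru.
Qed.

Lemma measurable_increment2 u : measurable_fun setT u ->
  measurable_fun setT (increment2 u).
Proof.
move=> mu_.
apply: (@measurable_integral_snd _ _ _ _ _ mu P
  (fun z : RR => ((u z.2 - u (z.2 + z.1)) ^+ 2)%:E)) => //.
- apply/measurable_EFinP; apply: measurable_funX; apply: measurable_funB.
    exact: measurableT_comp.
  apply: (measurableT_comp mu_ (f := u) (g := fun z : RR => z.2 + z.1)).
  by apply: measurable_funD.
- by move=> z; rewrite lee_fin sqr_ge0.
Qed.

End circle_increments.

(** * Convolution with a probability kernel *)

Section convolution.
Context {R : realType}.
Local Notation mu := (@lebesgue_measure R).
Local Notation P := (`[- pi, pi]%classic : set R).
Local Notation RR := (measurableTypeR R * measurableTypeR R)%type.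

Variables (K : R -> R) (B : R).
Hypotheses (mK : measurable_fun setT K) (K0 : forall x, 0 <= K x)
  (KB : forall x, K x <= B) (K1 : (\int[mu]_(x in P) K x = 1)%R).

Let KB' x : `|K x| <= B. Proof. by rewrite ger0_norm. Qed.

Let iK : mu.-integrable P (EFin \o K).
Proof. by apply: (bounded_integrable _ period_lty mK KB'). Qed.

Let K1E : (\int[mu]_(x in P) (K x)%:E = 1)%E.
Proof. by rewrite -[LHS]fineK ?integrable_fin_num//; congr (_%:E). Qed.

(** Jensen's inequality in [s] at each [x], then Tonelli. *)
Lemma sqnorm_mean_le (U : R -> R -> R) (g : R -> R) :
  measurable_fun [set: RR] (fun z : RR => U z.1 z.2) -> measurable_fun setT g ->
  (forall x, P x -> (sqnorm (U x) < +oo)%E) ->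
  (forall x, P x -> g x = (\int[mu]_(s in P) (K s * U x s))%R) ->
  (sqnorm g <= \int[mu]_(s in P) ((K s)%:E * sqnorm (U ^~ s)))%E.
Proof.
move=> mU mg Ufin gE.
have mUx x : measurable_fun setT (U x).
  exact: (measurableT_comp mU (pair1_measurable (x : measurableTypeR R))).
have mUs s : measurable_fun setT (U ^~ s).
  exact: (measurableT_comp mU (pair2_measurable (s : measurableTypeR R))).
pose f (z : RR) := (K z.2 * U z.1 z.2 ^+ 2)%:E.
have mf : measurable_fun [set: RR] f.
  apply/measurable_EFinP; apply: measurable_funM; last exact: measurable_funX.
  by apply: measurableT_comp.
have f0 z : (0 <= f z)%E by rewrite lee_fin mulr_ge0// sqr_ge0.
apply: (@le_trans _ _ (\int[mu]_(x in P) \int[mu]_(s in P) f (x, s))%E).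
  apply: ge0_le_integral => //.
  - by move=> x _; rewrite lee_fin sqr_ge0.
  - by apply: measurable_funTS; exact: measurable_sqr.
  - by apply: measurable_funTS; exact: measurable_integral_snd.
  - move=> x Px; rewrite gE//.
    exact: (jensen_sqr _ period_lty mK K0 KB K1 (mUx x) (Ufin x Px)).
rewrite tonelli_sets//.
rewrite le_eqVlt; apply/orP; left; apply/eqP; apply: eq_integral => s _.
rewrite -ge0_integralZl//=.
- by apply: measurable_funTS; exact: measurable_sqr.
- by move=> x _; rewrite lee_fin sqr_ge0.
- by rewrite lee_fin.
Qed.

Variable h : R -> R.
Hypotheses (mh : measurable_fun setT h) (perh : forall x, h (x + pi *+ 2) = h x)
  (h2 : (sqnorm h < +oo)%E).

Variable g : R -> R.
Hypotheses (mg : measurable_fun setT g)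
  (gE : forall x, `|x| <= pi *+ 2 ->
    g x = (\int[mu]_(s in P) (K s * h (x + s)))%R).

Let mshift (x : R) : measurable_fun setT (fun s : R => h (x + s)).
Proof.
have -> : (fun s => h (x + s)) = translate x h.
  by apply/funext => s; rewrite /translate addrC.
exact: measurable_translate.
Qed.

Let fshift (x : R) : `|x| <= pi *+ 2 -> (sqnorm (fun s => h (x + s))%R < +oo)%E.
Proof.
move=> x2; have -> : (fun s => h (x + s)) = translate x h.
  by apply/funext => s; rewrite /translate addrC.
by rewrite sqnorm_translate.
Qed.

Let iKshift (x : R) : `|x| <= pi *+ 2 ->
  mu.-integrable P (EFin \o (fun s => K s * h (x + s))).
Proof.
move=> x2; apply: (bounded_integrableM (mu := mu) _ mK KB') => //.
apply: (sqr_integrable_integrable _ period_lty) => //; first exact: mshift.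
exact: fshift.
Qed.

Let madd (u : RR -> R) : measurable_fun setT u ->
  measurable_fun [set: RR] (fun z => h (u z)).
Proof. by move=> ?; exact: measurableT_comp. Qed.

(** The increments of [g] are averages of increments of translates of [h], and
    translation does not change the norm of an increment. *)
Lemma increment2_convolution t : P t -> (increment2 g t <= increment2 h t)%E.
Proof.
move=> Pt; pose U x s := h (x + s) - h (x + t + s).
have := @sqnorm_mean_le U (fun x => g x - g (x + t)).
have -> : (\int[mu]_(s in P) ((K s)%:E * sqnorm (U ^~ s)) = increment2 h t)%E.
  transitivity (\int[mu]_(s in P) ((K s)%:E * increment2 h t))%E.
    apply: eq_integral => s /[!inE] Ps; congr (_ * _)%E.
    rewrite -(@increment2_translate _ s)//; exact: period_norm_le.
  rewrite ge0_integralZr//=; first by rewrite K1E mul1e.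
  - by apply/measurable_EFinP; exact: measurable_funTS.
  - by move=> x _; rewrite lee_fin.
  - exact: sqnorm_ge0.
apply.
- apply: measurable_funB; apply: madd; apply: measurable_funD => //.
  by apply: measurable_funD.
- by apply: measurable_funB => //; exact: measurable_translate.
- move=> x Px; apply: (le_lt_trans (sqnormB (mshift x) (mshift (x + t)))).
  rewrite lte_add_pinfty// lte_mul_pinfty// fshift//.
    exact: period_norm_le.
  exact: period_normD_le.
- move=> x Px; rewrite !gE ?(period_norm_le Px) ?(period_normD_le Px Pt)//.
  rewrite -RintegralB//; first last.
  + by apply: iKshift; exact: period_normD_le.
  + by apply: iKshift; exact: period_norm_le.
  by apply: eq_Rintegral => s _; rewrite -mulrBr.
Qed.

(** As [K] has mass 1, [h - g] is the average over [s] of the increments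
    [h x - h (x + s)]. *)
Lemma sqnorm_sub_convolution :
  (sqnorm (h \- g)%R <= \int[mu]_(s in P) ((K s)%:E * increment2 h s))%E.
Proof.
pose U x s := h x - h (x + s).
apply: (@sqnorm_mean_le U).
- apply: measurable_funB; apply: madd => //.
  by apply: measurable_funD.
- exact: measurable_funB.
- move=> x Px.
  have fc : (sqnorm (fun=> h x) < +oo)%E.
    rewrite /sqnorm integral_cst// lte_mul_pinfty ?period_lty//.
    by rewrite lee_fin sqr_ge0.
  have mc : measurable_fun setT (fun _ : R => h x) by exact: measurable_cst.
  apply: (le_lt_trans (sqnormB mc (mshift x))).
  by rewrite lte_add_pinfty// lte_mul_pinfty// fshift//; exact: period_norm_le.
- move=> x Px /=; rewrite gE ?period_norm_le//.
  transitivity (\int[mu]_(s in P) (K s * h x - K s * h (x + s)))%R; last first.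
    by apply: eq_Rintegral => s _; rewrite -mulrBr.
  rewrite RintegralB//.
  + by rewrite RintegralZr// K1 mul1r.
  + have := integrableZr _ (h x) iK.
    by move=> /(_ (measurable_itv _)); congr (integrable _ _ _); apply/funext.
  + by apply: iKshift; exact: period_norm_le.
Qed.

End convolution.

(** * The energy of a function on the circle *)

Lemma measurable_inv {R : realType} : measurable_fun setT (@GRing.inv R).
Proof.
have -> : [set: R] = [set x | x != 0] `|` [set 0].
  apply/seteqP; split => x // _ /=.
  by have [->|?] := eqVneq x 0; [right|left].
have o0 : open [set x : R | x != 0] by exact: open_neq.
apply/measurable_funU.
- exact: open_measurable.
- exact: measurable_set1.
split; last exact: measurable_fun_set1.
apply: open_continuous_measurable_fun => //.
by apply/in_setP => x /= x0; exact: inv_continuous.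
Qed.

Section energy.
Context {R : realType}.
Local Notation mu := (@lebesgue_measure R).
Local Notation P := (`[- pi, pi]%classic : set R).
Implicit Types (h g u v K : R -> R) (s t x : R).

(** Up to the factor 4, the inverse square of the length of the chord between
    two points of the unit circle at angle [t]. *)
Definition chord_weight t : R := (sin (t / 2) ^+ 2)^-1.

(** The squared homogeneous Sobolev seminorm of order 1/2 on the circle, up to a
    constant, written with the increment as the outer variable. *)
Definition circle_energy u : \bar R :=
  (\int[mu]_(t in P) (increment2 u t * (chord_weight t)%:E))%E.

Lemma chord_weight_ge0 t : 0 <= chord_weight t.
Proof. by rewrite invr_ge0 sqr_ge0. Qed.

Lemma increment2_ge0 u t : (0 <= increment2 u t)%E.
Proof. exact: sqnorm_ge0. Qed.

Lemma increment20 u : increment2 u 0 = 0%E.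
Proof.
by apply: integral0_eq => x _; rewrite addr0 subrr expr0n.
Qed.

Lemma sin_half_neq0 t : P t -> t != 0 -> sin (t / 2) != 0.
Proof.
rewrite /= in_itv/= => /andP[tl tu] t0; have pi0 := @pi_gt0 R.
have [t_gt0|t_le0] := ltP 0 t.
  by rewrite gt_eqF// sin_gt0_pi//; apply/andP; split; lra.
have {t_le0 t0} t_lt0 : t < 0 by rewrite lt_neqAle t0.
rewrite -[t / 2]opprK sinN oppr_eq0 gt_eqF// sin_gt0_pi//.
by apply/andP; split; lra.
Qed.

Lemma measurable_chord_weight : measurable_fun setT chord_weight.
Proof.
apply: measurableT_comp; first exact: measurable_inv.
apply: measurable_funX; apply: (measurableT_comp (f := @sin R)).
  by apply: continuous_measurable_fun; exact: continuous_sin.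
exact: measurable_funM.
Qed.

Lemma circle_energy_ge0 u : (0 <= circle_energy u)%E.
Proof.
by apply: integral_ge0 => t _; rewrite mule_ge0 ?increment2_ge0// lee_fin chord_weight_ge0.
Qed.

Lemma measurable_energy_density u : measurable_fun setT u ->
  measurable_fun setT (fun t => increment2 u t * (chord_weight t)%:E)%E.
Proof.
move=> mu_; apply: emeasurable_funM; first exact: measurable_increment2.
by apply/measurable_EFinP; exact: measurable_chord_weight.
Qed.

(** A kernel concentrated near 0 turns the energy into a bound on the mean
    increment; through this bound finite energy yields the convergence in
    quadratic mean of the convolutions. *)
Lemma kernel_increment_le u K c : measurable_fun setT u ->
  measurable_fun setT K -> (forall x, 0 <= K x) ->
  (forall t, P t -> K t * sin (t / 2) ^+ 2 <= c) ->
  (\int[mu]_(t in P) ((K t)%:E * increment2 u t) <= c%:E * circle_energy u)%E.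
Proof.
move=> mu_ mK K0 Kc.
have pi0 := @pi_gt0 R.
have c0 : 0 <= c.
  apply: le_trans (Kc 0 _); first by rewrite mulr_ge0// sqr_ge0.
  by rewrite /= in_itv/=; apply/andP; split; lra.
have mIw := measurable_funTS (measurable_energy_density mu_) : measurable_fun P _.
have Iw0 t : (0 <= increment2 u t * (chord_weight t)%:E)%E.
  by rewrite mule_ge0 ?increment2_ge0// lee_fin chord_weight_ge0.
rewrite /circle_energy -ge0_integralZl//=.
apply: ge0_le_integral => //.
- by move=> t _; rewrite mule_ge0 ?lee_fin// increment2_ge0.
- apply: measurable_funTS; apply: emeasurable_funM; first exact/measurable_EFinP.
  exact: measurable_increment2.
- exact: measurable_funeM.
- move=> t Pt; have [->|t0] := eqVneq t 0.
    by rewrite increment20 mul0e !mule0.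
  rewrite muleCA muleC lee_wpmul2l ?increment2_ge0// -EFinM lee_fin.
  have s0 : 0 < sin (t / 2) ^+ 2 by rewrite exprn_even_gt0//= sin_half_neq0.
  by rewrite /chord_weight ler_pdivlMr// Kc.
Qed.

(** The increments of [u - v n] are dominated by 4 times those of [u], and by 4
    times the squared norm of [u - v n], which tends to 0. So the energy
    densities converge to 0 pointwise, and dominated convergence in the
    increment variable applies. *)
Lemma circle_energy_cvg0 u (v : nat -> R -> R) (c : nat -> R) :
  measurable_fun setT u -> (forall n, measurable_fun setT (v n)) ->
  (forall x, u (x + pi *+ 2) = u x) ->
  (forall n x, v n (x + pi *+ 2) = v n x) ->
  (circle_energy u < +oo)%E ->
  (forall n t, P t -> (increment2 (v n) t <= increment2 u t)%E) ->
  (forall n, (sqnorm (u \- v n)%R <= (c n)%:E)%E) -> c n @[n --> \oo] --> 0 ->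
  circle_energy (u \- v n)%R @[n --> \oo] --> 0%E.
Proof.
move=> mu_ mv peru perv Eu Iv nc c0.
have mw n : measurable_fun setT (u \- v n) by exact: measurable_funB.
have Iw0 w t : (0 <= increment2 w t * (chord_weight t)%:E)%E.
  by rewrite mule_ge0 ?increment2_ge0// lee_fin chord_weight_ge0.
have [] := @dominated_convergence _ _ R mu P (measurable_itv _)
  (fun n t => increment2 (u \- v n)%R t * (chord_weight t)%:E)%E (cst 0)%E
  (fun t => 4%:E * (increment2 u t * (chord_weight t)%:E))%E.
- by move=> n; apply: measurable_funTS; exact: measurable_energy_density.
- exact: measurable_cst.
- apply: aeW => t Pt.
  apply: (@squeeze_cvge _ _ _ _ (cst 0)%E _
    (fun n => (4 * c n * chord_weight t)%:E)).
  + apply: nearW => n; rewrite Iw0/= EFinM lee_wpmul2r//.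
      by rewrite lee_fin chord_weight_ge0.
    apply: (le_trans (increment2_le_sqnorm (mw n) _ (period_norm_le Pt))).
      by move=> x /=; rewrite peru perv.
    by rewrite EFinM lee_wpmul2l.
  + exact: cvg_cst.
  + apply/cvg_EFin; first exact: nearW.
    have : 4 * c n * chord_weight t @[n --> \oo] --> 4 * 0 * chord_weight t.
      by apply: cvgM; [apply: cvgM => //; exact: cvg_cst|exact: cvg_cst].
    by rewrite mulr0 mul0r.
- apply: integrableZl => //; apply/integrableP; split.
    by apply: measurable_funTS; exact: measurable_energy_density.
  by under eq_integral do rewrite gee0_abs//.
- apply: aeW => t n Pt; rewrite gee0_abs// muleA lee_wpmul2r//.
    by rewrite lee_fin chord_weight_ge0.
  apply: (le_trans (increment2B t mu_ (mv n))).
  have -> : (4%:E = 2%:E + 2%:E :> \bar R)%E.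
    by rewrite -EFinD; congr (_%:E); ring.
  rewrite ge0_muleDl ?lee_fin// leeD2l// lee_wpmul2l//.
  exact: Iv.
- by move=> _ _; rewrite integral0.
Qed.

End energy.

(** * Convolution with a polynomial in the cosine *)

Lemma horner_bounded {R : realType} (p : {poly R}) (M : R) :
  exists B, forall c, `|c| <= M -> `|p.[c]| <= B.
Proof.
elim/poly_ind: p => [|p a [B IH]].
  by exists 0 => c _; rewrite horner0 normr0.
exists (B * M + `|a|) => c cM; rewrite hornerMXaddC.
apply: (le_trans (ler_normD _ _)); rewrite lerD2r normrM.
by rewrite ler_pM// IH.
Qed.

Section finite_energy.
Context {R : realType}.
Local Notation mu := (@lebesgue_measure R).
Local Notation P := (`[- pi, pi]%classic : set R).
Local Notation RR := (measurableTypeR R * measurableTypeR R)%type.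

Lemma sqnorm_cst_lty (c : R) : (sqnorm (fun=> c) < +oo)%E.
Proof.
rewrite /sqnorm integral_cst// lte_mul_pinfty ?period_lty//.
by rewrite lee_fin sqr_ge0.
Qed.

(** The chord weight is at least 1, so finite energy bounds the integral of
    (u x - u (x + t))^2 over x and t; for a suitable x this says that u minus
    the constant u x is square integrable. *)
Lemma sqnorm_lty_circle_energy (u : R -> R) : measurable_fun setT u ->
  (forall x, u (x + pi *+ 2) = u x) -> (circle_energy u < +oo)%E ->
  (sqnorm u < +oo)%E.
Proof.
move=> mu_ peru Eu; have pi0 := @pi_gt0 R.
pose f (z : RR) := ((u z.1 - u (z.1 + z.2)) ^+ 2)%:E.
have mf : measurable_fun [set: RR] f.
  apply/measurable_EFinP; apply: measurable_funX; apply: measurable_funB.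
    exact: measurableT_comp.
  apply: (measurableT_comp mu_ (f := u) (g := fun z : RR => z.1 + z.2)).
  by apply: measurable_funD.
have f0 z : (0 <= f z)%E by rewrite lee_fin sqr_ge0.
have ffin : (\int[mu]_(x in P) \int[mu]_(t in P) f (x, t) < +oo)%E.
  rewrite tonelli_sets//; apply: le_lt_trans Eu.
  apply: ge0_le_integral => //.
  - by move=> t _; exact: increment2_ge0.
  - by apply: measurable_funTS; exact: (measurable_increment2 mu_).
  - by apply: measurable_funTS; exact: (measurable_energy_density mu_).
  - move=> t Pt.
    change (increment2 u t <= increment2 u t * (chord_weight t)%:E)%E.
    have [->|t0] := eqVneq t 0; first by rewrite increment20 mul0e.
    rewrite -[leLHS]mule1 lee_wpmul2l ?increment2_ge0// lee_fin.
    have s0 : 0 < sin (t / 2) ^+ 2 by rewrite exprn_even_gt0//= sin_half_neq0.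
    rewrite invf_ge1// sin2cos2; have := sqr_ge0 (cos (t / 2)); lra.
have [x Px ux] : exists2 x, P x & (\int[mu]_(t in P) f (x, t) < +oo)%E.
  apply: contrapT => /forall2NP noP; move: ffin.
  rewrite (eq_integral (cst +oo)%E) => [|x /[!inE] Px].
    rewrite integral_cst// [X in (_ * X)%E]lebesgue_measure_period mulyr gtr0_sg ?pi2_gt0//.
    by rewrite mul1e.
  have [//|/negP] := noP x; rewrite -leNgt leye_eq => /eqP //.
rewrite -(sqnorm_translate mu_ peru (period_norm_le Px)).
have -> : translate x u = (fun=> u x) \- (fun t => u x - u (x + t)).
  by apply/funext => t /=; rewrite /translate [t + x]addrC; ring.
have mc : measurable_fun setT (fun _ : R => u x) by exact: measurable_cst.
have mt := measurable_translate x mu_.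
have md : measurable_fun setT (fun t => u x - u (x + t)).
  have -> : (fun t => u x - u (x + t)) = (fun t => u x - translate x u t).
    by apply/funext => t; rewrite /translate [t + x]addrC.
  exact: (measurable_funB mc mt).
apply: (le_lt_trans (sqnormB mc md)).
by rewrite lte_add_pinfty// lte_mul_pinfty// ?sqnorm_ge0// sqnorm_cst_lty.
Qed.

Lemma Rintegral_odd (g : R -> R) : mu.-integrable P (EFin \o g) ->
  (forall u, g (- u) = - g u) -> (\int[mu]_(u in P) g u)%R = 0.
Proof.
move=> ig gN; have mg := measurable_int _ ig.
rewrite /Rintegral integralE.
rewrite [X in (X - _)%E]integral_opp//; last exact: measurable_funepos.
rewrite opp_preimage_itvbndbnd/= opprK.
rewrite (_ : (fun x => _) = ((EFin \o g)^\-)%E); last first.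
  by apply/funext => x; rewrite funeposE funenegE /= gN.
by rewrite subee// integrable_neg_fin_num.
Qed.

(** Since [cos (u - x) = cos u * cos x + sin u * sin x], each factor
    [cos (u - x)] replaces [g] by [cos * g], of the same parity, or by
    [sin * g], of the opposite parity; so the induction on [k] carries both
    parities. The constant term of [k] contributes the integral of [g], which
    vanishes for odd [g]. *)
Lemma convolution_horner_cos (k : {poly R}) :
  (forall g : R -> R, mu.-integrable P (EFin \o g) -> (forall u, g (- u) = g u) ->
   exists p : {poly R}, forall x,
     (\int[mu]_(u in P) (k.[cos (u - x)] * g u))%R = p.[cos x]) /\
  (forall g : R -> R, mu.-integrable P (EFin \o g) -> (forall u, g (- u) = - g u) ->
   exists p : {poly R}, forall x,
     (\int[mu]_(u in P) (k.[cos (u - x)] * g u))%R = sin x * p.[cos x]).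
Proof.
have cosb (x : R) : `|cos x| <= 1 by exact: cos_max.
have sinb (x : R) : `|sin x| <= 1 by exact: sin_max.
have mcos : measurable_fun setT (@cos R).
  by apply: continuous_measurable_fun; exact: continuous_cos.
have msin : measurable_fun setT (@sin R).
  by apply: continuous_measurable_fun; exact: continuous_sin.
have icos (g : R -> R) : mu.-integrable P (EFin \o g) ->
    mu.-integrable P (EFin \o (fun u => cos u * g u)).
  exact: (bounded_integrableM (mu := mu) _ mcos cosb).
have isin (g : R -> R) : mu.-integrable P (EFin \o g) ->
    mu.-integrable P (EFin \o (fun u => sin u * g u)).
  exact: (bounded_integrableM (mu := mu) _ msin sinb).
have iZ (r : R) (g : R -> R) : mu.-integrable P (EFin \o g) ->
    mu.-integrable P (EFin \o (fun u => r * g u)).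
  move=> ig; have := integrableZl (mu := mu) (measurable_itv _) r ig.
  by congr (integrable _ _ _); apply/funext.
have iq (q : {poly R}) (g : R -> R) x : mu.-integrable P (EFin \o g) ->
    mu.-integrable P (EFin \o (fun u => q.[cos (u - x)] * g u)).
  have [B qB] := horner_bounded q 1.
  apply: (bounded_integrableM (mu := mu) _ _ (B := B)) => //.
  - apply: (measurableT_comp (f := horner q)).
      by apply: continuous_measurable_fun; exact: continuous_horner.
    by apply: measurableT_comp => //; exact: measurable_funB.
  - by move=> u; exact: qB.
have step (q : {poly R}) (c : R) (g : R -> R) x : mu.-integrable P (EFin \o g) ->
    (\int[mu]_(u in P) ((q * 'X + c%:P).[cos (u - x)] * g u))%R =
    cos x * (\int[mu]_(u in P) (q.[cos (u - x)] * (cos u * g u)))%R +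
    sin x * (\int[mu]_(u in P) (q.[cos (u - x)] * (sin u * g u)))%R +
    c * (\int[mu]_(u in P) g u)%R.
  move=> ig.
  rewrite -!RintegralZl//; [|exact: iq (isin _ ig)|exact: iq (icos _ ig)].
  have I1 := iZ (cos x) _ (iq q _ x (icos _ ig)).
  have I2 := iZ (sin x) _ (iq q _ x (isin _ ig)).
  have I3 := iZ c _ ig.
  rewrite -RintegralD// -RintegralD//.
    by apply: eq_Rintegral => u _; rewrite hornerMXaddC cosB; ring.
  have := integrableD (mu := mu) (measurable_itv _) I1 I2.
  by congr (integrable _ _ _); apply/funext.
elim/poly_ind: k => [|q c [IHe IHo]].
  have I0 (g : R -> R) x :
      (\int[mu]_(u in P) ((0 : {poly R}).[cos (u - x)] * g u))%R = 0.
    under eq_Rintegral do rewrite horner0 mul0r.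
    by rewrite Rintegral_cst// mul0r.
  by split=> g _ _; exists 0 => x; rewrite I0 horner0 ?mulr0.
split=> g ig gN.
  have [|p1 Hp1] := IHe _ (icos _ ig); first by move=> u; rewrite cosN gN.
  have [|p2 Hp2] := IHo _ (isin _ ig).
    by move=> u; rewrite sinN gN mulNr.
  exists ('X * p1 + (1 - 'X ^+ 2) * p2 + (c * (\int[mu]_(u in P) g u)%R)%:P) => x.
  by rewrite step// Hp1 Hp2 [sin x * (sin x * _)]mulrA -expr2 sin2cos2 !hornerE.
have [|p1 Hp1] := IHo _ (icos _ ig); first by move=> u; rewrite cosN gN mulrN.
have [|p2 Hp2] := IHe _ (isin _ ig).
  by move=> u; rewrite sinN gN mulrNN.
exists ('X * p1 + p2) => x.
by rewrite step// Hp1 Hp2 Rintegral_odd// hornerD hornerM hornerX; ring.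
Qed.

End finite_energy.

(** * Approximation on the circle *)

Section approximation.
Context {R : realType}.
Local Notation mu := (@lebesgue_measure R).
Local Notation P := (`[- pi, pi]%classic : set R).

Lemma Rintegral_period_shift s (F : R -> R) : measurable_fun setT F ->
  (forall x, F (x + pi *+ 2) = F x) -> `|s| <= pi *+ 2 ->
  (\int[mu]_(x in P) F (x + s)%R = \int[mu]_(x in P) F x)%R.
Proof.
move=> mF perF s2; have mFE : measurable_fun setT (EFin \o F).
  exact/measurable_EFinP.
rewrite /Rintegral integralE [in RHS]integralE; congr (fine (_ - _)).
- rewrite -[RHS](@integral_period_shift _ s) => [|||x|]//.
  + by apply: eq_integral => x _; rewrite !funeposE.
  + exact: measurable_funepos.
  + by rewrite !funeposE /= perF.
- rewrite -[RHS](@integral_period_shift _ s) => [|||x|]//.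
  + by apply: eq_integral => x _; rewrite !funenegE.
  + exact: measurable_funeneg.
  + by rewrite !funenegE /= perF.
Qed.

Lemma sin_sqr_le (y : R) : 0 <= y -> sin y ^+ 2 <= y ^+ 2.
Proof.
rewrite le_eqVlt => /predU1P[<-|y0]; first by rewrite sin0.
have dsin (x : R) : is_derive x 1 (@sin R) (cos x) by exact: is_derive_sin.
have [|c _] := MVT y0 (fun x _ => dsin x).
  by apply: continuous_subspaceT; exact: continuous_sin.
by rewrite sin0 !subr0 => ->; rewrite exprMn ler_piMl ?sqr_ge0.
Qed.

Lemma ler_bernoulli (a : R) n : 0 <= a <= 1 -> 1 - n%:R * a <= (1 - a) ^+ n.
Proof.
move=> /andP[a0 a1]; elim: n => [|n IH]; first by rewrite mul0r subr0.
rewrite exprS; apply: (@le_trans _ _ ((1 - a) * (1 - n%:R * a))); last first.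
  by rewrite ler_wpM2l// subr_ge0.
rewrite -natr1; have := mulr_ge0 (ler0n R n) (sqr_ge0 a); nra.
Qed.

(** Used through the bound 1 of the right-hand side; the sharper form is what
    the induction needs. *)
Lemma ler_exprM_onem (q : R) n : 0 <= q <= 1 ->
  n.+1%:R * (q ^+ n * (1 - q)) <= 1 - q ^+ n.+1.
Proof.
move=> /andP[q0 q1]; elim: n => [|n IH]; first by rewrite mul1r expr0 mul1r.
have qn0 : 0 <= q ^+ n by rewrite exprn_ge0.
have qn1 : q ^+ n <= 1 by rewrite exprn_ile1.
move: IH; rewrite (exprS q n.+1) (exprS q n) -(natr1 n.+1).
set a := n.+1%:R; set b := q ^+ n => IH.
have := ler_wpM2l q0 IH; have : 0 <= (1 - b * q) * (1 - q); last by nra.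
by rewrite mulr_ge0 ?subr_ge0// mulr_ile1.
Qed.

(** A normalised power of [(1 + cos t) / 2 = cos (t / 2) ^+ 2]. With
    [M = m.+1] and exponent [M ^ 2], the mass before normalisation is at least
    of order [1 / M], because the power is at least 3/4 on [[0, 1 / M]], whereas
    its product with [sin (t / 2) ^+ 2] is at most of order [1 / M ^ 2]. *)
Lemma cosine_power_kernel (m : nat) : exists k : {poly R},
  [/\ forall x, 0 <= k.[cos x],
      exists B, forall x, k.[cos x] <= B,
      (\int[mu]_(x in P) k.[cos x])%R = 1 &
      forall t, k.[cos t] * sin (t / 2) ^+ 2 <= 2 / m.+1%:R].
Proof.
pose M : R := m.+1%:R; have M0 : 0 < M by rewrite ltr0n.
have M1 : 1 <= M by rewrite ler1n.
pose n := (m.+1 ^ 2)%N; have nM : n%:R = M ^+ 2 by rewrite natrX.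
pose q (x : R) := (1 + cos x) / 2.
have qE x : q x = 1 - sin (x / 2) ^+ 2.
  have -> : q x = (1 + cos ((x / 2) *+ 2)) / 2 by rewrite -mulr_natr divfK.
  by rewrite -cos2sin2 cos_mulr2n -mulr_natr; field.
have q01 x : 0 <= q x <= 1.
  by rewrite /q; have := cos_le1 x; have := cos_geN1 x => ? ?; apply/andP; split; lra.
have mq : measurable_fun setT (fun x => q x ^+ n).
  apply: measurable_funX; apply: measurable_funM => //.
  apply: measurable_funD => //.
  by apply: continuous_measurable_fun; exact: continuous_cos.
have qn0 x : 0 <= q x ^+ n by have /andP[? _] := q01 x; exact: exprn_ge0.
have qn1 x : q x ^+ n <= 1 by have /andP[? ?] := q01 x; exact: exprn_ile1.
have iq : mu.-integrable P (EFin \o (fun x => q x ^+ n)).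
  apply: (bounded_integrable (mu := mu) _ period_lty mq (B := 1)) => // x.
  by rewrite ger0_norm.
pose Z := (\int[mu]_(x in P) (q x ^+ n))%R.
have ZM : 3 / (4 * M) <= Z.
  rewrite -lee_fin /Z fineK; last exact: integrable_fin_num.
  apply: (@le_trans _ _ (\int[mu]_(x in `[0%R, M^-1%R]) (3 / 4)%:E)%E).
    rewrite integral_cst//= lebesgue_measure_itv/= lte_fin invr_gt0 M0.
    rewrite oppr0 adde0 -EFinM lee_fin.
    by rewrite le_eqVlt; apply/orP; left; apply/eqP; field; rewrite gt_eqF.
  apply: (@le_trans _ _ (\int[mu]_(x in `[0%R, M^-1%R]) (q x ^+ n)%:E)%E).
    apply: ge0_le_integral => //.
    - by apply/measurable_EFinP; exact: measurable_funTS.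
    - move=> x /=; rewrite in_itv/= => /andP[x0 xM]; rewrite lee_fin qE.
      have x2 : 0 <= x / 2 by rewrite divr_ge0.
      have s2 := sin_sqr_le x2.
      apply: le_trans (ler_bernoulli _ _); last first.
        by rewrite sqr_ge0/= sin2cos2 gerBl sqr_ge0.
      have : n%:R * sin (x / 2) ^+ 2 <= n%:R * (M^-1 / 2) ^+ 2.
        rewrite ler_wpM2l//; apply: (le_trans s2).
        by rewrite lerXn2r ?nnegrE ?divr_ge0 ?invr_ge0 ?(ltW M0)// ler_pM2r.
      rewrite nM (_ : M ^+ 2 * (M^-1 / 2) ^+ 2 = 1 / 4); first by lra.
      by field; rewrite gt_eqF.
  apply: ge0_subset_integral => //.
  - by apply/measurable_EFinP; exact: measurable_funTS.
  - by move=> x _; rewrite lee_fin.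
  - move=> x /=; rewrite !in_itv/= => /andP[x0 xM].
    have pi2 := @pi_ge2 R; have Minv : M^-1 <= 1 by rewrite invf_le1.
    have x1 := le_trans xM Minv.
    by apply/andP; split; lra.
have Z0 : 0 < Z by apply: lt_le_trans ZM; rewrite divr_gt0// mulr_gt0.
have kE x : (Z^-1 *: ((2^-1)%:P * (1%:P + 'X)) ^+ n).[cos x] = Z^-1 * q x ^+ n.
  rewrite hornerZ horner_exp hornerM hornerD !hornerC hornerX.
  by rewrite /q [2^-1 * _]mulrC.
exists (Z^-1 *: ((2^-1)%:P * (1%:P + 'X)) ^+ n); split.
- by move=> x; rewrite kE mulr_ge0// invr_ge0 ltW.
- by exists Z^-1 => x; rewrite kE ler_piMr// invr_ge0 ltW.
- under eq_Rintegral do rewrite kE.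
  by rewrite RintegralZl// mulVf// gt_eqF.
- move=> t; rewrite kE -mulrA mulrC ler_pdivrMr//.
  have -> : sin (t / 2) ^+ 2 = 1 - q t by rewrite qE; ring.
  apply: (@le_trans _ _ (2 / M * (3 / (4 * M)))); last first.
    by rewrite ler_wpM2l// divr_ge0// ltW.
  have := ler_exprM_onem n (q01 t).
  have : 0 <= q t ^+ n.+1 by rewrite exprn_ge0//; have /andP[] := q01 t.
  rewrite -natr1 nM => h1 h2.
  rewrite (_ : 2 / M * (3 / (4 * M)) = (3 / 2) / M ^+ 2); last first.
    by field; rewrite gt_eqF.
  have h3 : 0 <= q t ^+ n * (1 - q t).
    by rewrite mulr_ge0// subr_ge0; have /andP[] := q01 t.
  rewrite ler_pdivlMr ?exprn_gt0// mulrC; nra.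
Qed.

Lemma continuous_horner_cos (p : {poly R}) : continuous (fun x : R => p.[cos x]).
Proof.
move=> x; apply: (@continuous_comp _ _ _ (@cos R) (horner p)).
  exact: continuous_cos.
exact: continuous_horner.
Qed.

Lemma horner_cos_periodic (p : {poly R}) (x : R) : p.[cos (x + pi *+ 2)] = p.[cos x].
Proof. by rewrite cosD2pi. Qed.

(** The approximants are the convolutions of [u] with the kernels of
    [cosine_power_kernel]; since [u] is even they are polynomials in the cosine. *)
Theorem cosine_polynomial_approximation (u : R -> R) : measurable_fun setT u ->
  (forall x, u (x + pi *+ 2) = u x) -> (forall x, u (- x) = u x) ->
  (circle_energy u < +oo)%E ->
  exists p : nat -> {poly R},
    circle_energy (fun x => u x - (p n).[cos x])%R @[n --> \oo] --> 0%E.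
Proof.
move=> mu_ peru evenu Eu; have u2 := sqnorm_lty_circle_energy mu_ peru Eu.
have iu : mu.-integrable P (EFin \o u).
  by apply: (sqr_integrable_integrable _ period_lty).
have [k kP] := choice cosine_power_kernel.
pose K n x := (k n).[cos x].
have mhc (p : {poly R}) : measurable_fun setT (fun x : R => p.[cos x]).
  by apply: continuous_measurable_fun; exact: continuous_horner_cos.
have [p pP] := choice (fun n => (convolution_horner_cos (k n)).1 u iu evenu).
have pconv n x : `|x| <= pi *+ 2 ->
    (p n).[cos x] = (\int[mu]_(s in P) (K n s * u (x + s)))%R.
  move=> x2; rewrite -pP -(@Rintegral_period_shift x)//.
  - by apply: eq_Rintegral => s _; rewrite addrK addrC.
  - apply: measurable_funM => //; apply: (measurableT_comp (mhc (k n))).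
    exact: measurable_funB.
  - by move=> s; rewrite peru addrAC horner_cos_periodic.
exists p.
apply: (@circle_energy_cvg0 _ u (fun n x => (p n).[cos x])
  (fun n => 2 / n.+1%:R * fine (circle_energy u))) => //.
- by move=> n x; rewrite horner_cos_periodic.
- move=> n t Pt; have [K0 [B KB] K1 Ks] := kP n.
  exact: (increment2_convolution (mhc _) K0 KB K1 mu_ peru u2 (mhc _) (pconv n)).
- move=> n; have [K0 [B KB] K1 Ks] := kP n.
  apply: (le_trans (sqnorm_sub_convolution (mhc _) K0 KB K1 mu_ peru u2 (mhc _) (pconv n))).
  apply: (le_trans (kernel_increment_le mu_ (mhc _) K0 (fun t _ => Ks t))).
  by rewrite [leRHS]EFinM fineK// ge0_fin_numE// circle_energy_ge0.
- have : (2 / n.+1%:R * fine (circle_energy u)) @[n --> \oo] -->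
      2 * 0 * fine (circle_energy u).
    apply: cvgM; last exact: cvg_cst.
    by apply: cvgM; [exact: cvg_cst|exact: cvg_harmonic].
  by rewrite mulr0 mul0r.
Qed.

End approximation.

(** * The LUE variance as a circle energy *)

Section LUE.
Context {R : realType}.
Local Notation mu := (@lebesgue_measure R).
Local Notation P := (`[- pi, pi]%classic : set R).
Local Notation RR := (measurableTypeR R * measurableTypeR R)%type.

Lemma measurable_sqrt : measurable_fun setT (@Num.sqrt R).
Proof. by apply: continuous_measurable_fun; exact: sqrt_continuous. Qed.

Lemma measurable_div (f g : RR -> R) : measurable_fun setT f ->
  measurable_fun setT g -> measurable_fun setT (fun z => f z / g z).
Proof.
move=> mf mg; apply: measurable_funM => //.
by apply: measurableT_comp => //; exact: measurable_inv.
Qed.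

Lemma measurable_swap (u : RR -> R) : measurable_fun [set: RR] u ->
  measurable_fun [set: RR] (fun z : RR => u (z.2, z.1)).
Proof.
move=> mu_.
apply: (measurableT_comp mu_ (f := u) (g := fun z : RR => (z.2, z.1) : RR)).
exact: measurable_fun_pair.
Qed.

Lemma measurable_diffquot2 (g : R -> R) : measurable_fun setT g ->
  measurable_fun [set: RR] (fun z : RR => diffquot2 g z.1 z.2).
Proof.
move=> mg; apply: measurable_funX; apply: measurable_div.
  by apply: measurable_funB; apply: measurableT_comp.
exact: measurable_funB.
Qed.

Lemma measurable_LUE_weight :
  measurable_fun [set: RR] (fun z : RR => LUE_weight z.1 z.2).
Proof.
have mB (f : RR -> R) : measurable_fun setT f -> measurable_fun setT (fun z => f z - 2).
  by move=> mf; apply: measurable_funB.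
apply: measurable_div.
  by apply: measurable_funB => //; apply: measurable_funM; exact: mB.
apply: measurable_funM.
  apply: measurable_funM => //; apply: measurableT_comp; first exact: measurable_sqrt.
  by apply: measurable_funB => //; apply: measurable_funX; exact: mB.
apply: measurableT_comp; first exact: measurable_sqrt.
by apply: measurable_funB => //; apply: measurable_funX; exact: mB.
Qed.

Lemma LUE_weight_ge0 (x y : R) : 0 <= LUE_weight x y.
Proof.
rewrite /LUE_weight.
have [x4|x4] := leP (4 - (x - 2) ^+ 2) 0.
  by rewrite (ler0_sqrtr x4) mulr0 mul0r invr0 mulr0.
have [y4|y4] := leP (4 - (y - 2) ^+ 2) 0.
  by rewrite (ler0_sqrtr y4) mulr0 invr0 mulr0.
apply: divr_ge0; last by rewrite !mulr_ge0 ?sqrtr_ge0 ?sqr_ge0 ?pi_ge0.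
have := sqr_ge0 ((x - 2) - (y - 2)); nra.
Qed.

Lemma diffquot2_ge0 (g : R -> R) x y : 0 <= diffquot2 g x y.
Proof. exact: sqr_ge0. Qed.

(** With [a = sin ((t - s) / 2)] and [b = sin ((t + s) / 2)] one has
    [cos t - cos s = - 2 * a * b] and [1 - cos t * cos s = a ^+ 2 + b ^+ 2], so
    the weight over the squared difference splits as [1 / a ^+ 2 + 1 / b ^+ 2]. *)
Lemma LUE_weight_circle_map (g : R -> R) (s t : R) :
  0 < s < pi -> 0 < t < pi ->
  diffquot2 g (circle_map t) (circle_map s) *
    LUE_weight (circle_map t) (circle_map s) * (2 * `|sin t|) * (2 * `|sin s|) =
  (16 * pi ^+ 2)^-1 * ((g (circle_map s) - g (circle_map t)) ^+ 2 *
     (chord_weight (t - s) + chord_weight (t + s))).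
Proof.
move=> s0 t0; have [<-|ts] := eqVneq t s.
  by rewrite /diffquot2 !subrr invr0 mulr0 expr0n/= !mul0r mulr0.
have sins := sin_gt0_pi s0; have sint := sin_gt0_pi t0.
have pi0 := @pi_gt0 R.
pose A := (t + s) / 2; pose D := (t - s) / 2.
have tE : t = A + D by rewrite /A /D; field.
have sE : s = A - D by rewrite /A /D; field.
have /andP[s1 s2] := s0; have /andP[t1 t2] := t0.
have a0 : sin A != 0.
  by rewrite gt_eqF// sin_gt0_pi// /A; apply/andP; split; lra.
have d0 : sin D != 0.
  apply: sin_half_neq0; last by rewrite subr_eq0.
  by rewrite /= in_itv/=; apply/andP; split; lra.
have sqrtE x : 0 < sin x -> Num.sqrt (4 - (circle_map x - 2) ^+ 2) = 2 * sin x.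
  move=> sx; rewrite -[RHS]ger0_norm; last by rewrite mulr_ge0// ltW.
  rewrite -sqrtr_sqr; congr Num.sqrt.
  by rewrite /circle_map exprMn sin2cos2; ring.
rewrite /LUE_weight !sqrtE// !gtr0_norm// /diffquot2 /chord_weight -/A -/D.
have cosE : cos t - cos s = - 2 * sin A * sin D.
  by rewrite tE sE cosD cosB; ring.
have ccE : 1 - cos t * cos s = sin A ^+ 2 + sin D ^+ 2.
  by rewrite tE sE cosD cosB !sin2cos2; have := sin2cos2 A; have := sin2cos2 D; nra.
set gs := g (circle_map s); set gt := g (circle_map t).
have -> : circle_map t - circle_map s = - 4 * sin A * sin D.
  by rewrite /circle_map (_ : _ - _ = 2 * (cos t - cos s)); [rewrite cosE|]; ring.
have -> : 4 - (circle_map t - 2) * (circle_map s - 2) =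
    4 * (sin A ^+ 2 + sin D ^+ 2).
  by rewrite -ccE /circle_map; ring.
have p0 : (pi : R) != 0 by rewrite gt_eqF.
have [st0 ss0] : sin t != 0 /\ sin s != 0 by rewrite !gt_eqF.
move: p0; move: (@pi R) => p p0.
by field; rewrite a0 d0 p0 st0 ss0.
Qed.

Lemma chord_weight_periodic (t : R) : chord_weight (t + pi *+ 2) = chord_weight t.
Proof.
rewrite /chord_weight (_ : (t + pi *+ 2) / 2 = t / 2 + pi); last by field.
by rewrite sinDpi sqrrN.
Qed.

Lemma chord_weightN (t : R) : chord_weight (- t) = chord_weight t.
Proof. by rewrite /chord_weight mulNr sinN sqrrN. Qed.

(** The two chord weights belong to the points of the circle at angles [t] and
    [- t], which have the same cosine. *)
Definition folded_density (h : R -> R) (s t : R) : R :=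
  (h s - h t) ^+ 2 * (chord_weight (t - s) + chord_weight (t + s)).

Lemma folded_density_ge0 h s t : 0 <= folded_density h s t.
Proof. by rewrite mulr_ge0 ?sqr_ge0// addr_ge0// chord_weight_ge0. Qed.

Let mRR (h : R -> R) (u : RR -> R) : measurable_fun setT h ->
  measurable_fun setT u -> measurable_fun [set: RR] (fun z => h (u z)).
Proof. by move=> ? ?; exact: measurableT_comp. Qed.

Let mw : measurable_fun setT (@chord_weight R) := measurable_chord_weight.

Lemma measurable_folded_density (h : R -> R) : measurable_fun setT h ->
  measurable_fun [set: RR] (fun z : RR => (folded_density h z.1 z.2)%:E).
Proof.
move=> mh; apply/measurable_EFinP; apply: measurable_funM.
  by apply: measurable_funX; apply: measurable_funB; exact: mRR.
apply: measurable_funD; apply: mRR => //.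
  exact: measurable_funB.
exact: measurable_funD.
Qed.

(** Tonelli and a shift of the increment variable turn the energy into a double
    integral over pairs of points; evenness folds both variables onto [0, pi]. *)
Lemma circle_energy_fold (h : R -> R) : measurable_fun setT h ->
  (forall x, h (x + pi *+ 2) = h x) -> (forall x, h (- x) = h x) ->
  (circle_energy h = 2%:E * \int[mu]_(s in `[0%R, pi])
     \int[mu]_(t in `[0%R, pi]) (folded_density h s t)%:E)%E.
Proof.
move=> mh perh evenh.
pose f (z : RR) := ((h z.2 - h (z.2 + z.1)) ^+ 2 * chord_weight z.1)%:E.
have mf : measurable_fun [set: RR] f.
  apply/measurable_EFinP; apply: measurable_funM; last exact: mRR.
  apply: measurable_funX; apply: measurable_funB; apply: mRR => //.
  exact: measurable_funD.
have f0 z : (0 <= f z)%E by rewrite lee_fin mulr_ge0 ?sqr_ge0// chord_weight_ge0.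
have mD := measurable_folded_density mh.
have D0 (z : RR) : (0 <= (folded_density h z.1 z.2)%:E)%E.
  by rewrite lee_fin folded_density_ge0.
have mA := measurable_integral_snd mu (measurable_itv `[0, pi]) mD D0.
rewrite /= in mA.
pose A s := (\int[mu]_(t in `[0%R, pi]) (folded_density h s t)%:E)%E.
have A0 s : (0 <= A s)%E.
  by apply: integral_ge0 => t _; exact: (D0 (s, t)).
have AN s : A (- s) = A s.
  apply: eq_integral => t _; rewrite /folded_density evenh opprK.
  by rewrite [X in _ * X]addrC.
transitivity (\int[mu]_(r in P) \int[mu]_(x in P) f (r, x))%E.
  apply: eq_integral => r _; rewrite -ge0_integralZr//=.
  - apply: measurable_funTS; apply: measurable_sqr.
    by apply: measurable_funB => //; exact: measurable_translate.
  - by move=> x _; rewrite lee_fin sqr_ge0.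
  - by rewrite lee_fin chord_weight_ge0.
rewrite tonelli_sets//.
transitivity (\int[mu]_(x in P) A x)%E.
  apply: eq_integral => x /[!inE] Px.
  pose G (r : R) := ((h x - h r) ^+ 2 * chord_weight (r - x))%:E.
  have mG : measurable_fun setT G.
    apply/measurable_EFinP; apply: measurable_funM.
      by apply: measurable_funX; apply: measurable_funB.
    by apply: measurableT_comp => //; exact: measurable_funB.
  have G0 r : (0 <= G r)%E by rewrite lee_fin mulr_ge0 ?sqr_ge0// chord_weight_ge0.
  transitivity (\int[mu]_(r in P) G (r + x)%R)%E.
    by apply: eq_integral => r _; rewrite /f /G/= addrK [r + x]addrC.
  rewrite integral_period_shift//; last 2 first.
  - by move=> r; rewrite /G perh addrAC chord_weight_periodic.
  - exact: period_norm_le.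
  rewrite integral_fold//; apply: eq_integral => t _.
  rewrite /G evenh -EFinD -mulrDr /folded_density.
  by rewrite -[chord_weight (- t - x)]chord_weightN opprB opprK [x + t]addrC.
have mA' : measurable_fun setT A := mA.
rewrite (integral_fold mA' A0) -ge0_integralZl//=; last 2 first.
- exact: measurable_funTS mA'.
- by move=> s _; exact: A0.
apply: eq_integral => s _; rewrite AN.
by rewrite -[in RHS](_ : 1 + 1 = 2 :> R)// EFinD ge0_muleDl// !mul1e.
Qed.

Lemma eq_integral_itv_interior (a b : R) (F G : R -> \bar R) :
  measurable_fun setT F -> measurable_fun setT G ->
  (forall x, a < x < b -> F x = G x) ->
  (\int[mu]_(x in `[a, b]) F x = \int[mu]_(x in `[a, b]) G x)%E.
Proof.
move=> mF mG FG; rewrite !(@integral_itv_bndoo _ _ _ _ true false);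
  [|exact: measurable_funTS..].
by apply: eq_integral => x /[!inE]/=; rewrite in_itv/= => /FG.
Qed.

Lemma V_LUE_circle_energy (g : R -> R) : measurable_fun setT g ->
  (V_LUE g = ((32 * pi ^+ 2)^-1)%:E * circle_energy (g \o circle_map))%E.
Proof.
move=> mg; have pi0 := @pi_gt0 R.
have mT := @measurable_circle_map R.
have mh : measurable_fun setT (g \o circle_map).
  by apply: measurableT_comp => //; exact: mT.
rewrite circle_energy_fold//; last 2 first.
- by move=> x; rewrite /= /circle_map cosD2pi.
- by move=> x; rewrite /= /circle_map cosN.
pose f (z : RR) := (diffquot2 g z.2 z.1 * LUE_weight z.2 z.1)%:E.
have mf : measurable_fun [set: RR] f.
  apply/measurable_EFinP; apply: measurable_funM.
    exact: (measurable_swap (measurable_diffquot2 mg)).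
  exact: (measurable_swap measurable_LUE_weight).
have f0 z : (0 <= f z)%E.
  by rewrite lee_fin mulr_ge0 ?diffquot2_ge0// LUE_weight_ge0.
pose L (z : RR) := (f (circle_map z.1, circle_map z.2) *
  (2 * `|sin z.2|)%:E * (2 * `|sin z.1|)%:E)%E.
have msin : measurable_fun setT (fun x : R => (2 * `|sin x|)%:E).
  apply/measurable_EFinP; apply: measurable_funM => //.
  apply: measurableT_comp => //.
  by apply: continuous_measurable_fun; exact: continuous_sin.
have mL : measurable_fun [set: RR] L.
  apply: emeasurable_funM; last by apply: (measurableT_comp msin).
  apply: emeasurable_funM; last by apply: (measurableT_comp msin).
  apply: (measurableT_comp mf (f := f)
    (g := fun z : RR => (circle_map z.1, circle_map z.2) : RR)).
  by apply: measurable_fun_pair; apply: measurableT_comp.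
have L0 z : (0 <= L z)%E.
  by rewrite /L !mule_ge0 ?f0// lee_fin mulr_ge0.
pose c : R := (16 * pi ^+ 2)^-1.
have c0 : 0 <= c by rewrite invr_ge0 mulr_ge0// sqr_ge0.
pose D (z : RR) := (c%:E * (folded_density (g \o circle_map) z.1 z.2)%:E)%E.
have mD' := measurable_folded_density mh.
have mD : measurable_fun [set: RR] D by apply: measurable_funeM.
have D0 z : (0 <= D z)%E by rewrite mule_ge0// lee_fin// folded_density_ge0.
transitivity (\int[mu]_(s in `[0%R, pi]) \int[mu]_(t in `[0%R, pi]) L (s, t))%E.
  rewrite /V_LUE integral_circle_map; first last.
  - by move=> y; apply: integral_ge0 => x _; exact: (f0 (y, x)).
  - exact: (measurable_integral_snd mu _ mf f0).
  apply: eq_integral => s _.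
  have mfs : measurable_fun setT (fun x => f (circle_map s, x)).
    exact: (measurableT_comp mf (pair1_measurable (circle_map s : measurableTypeR R))).
  rewrite (@integral_circle_map _ (fun x => f (circle_map s, x)))//.
  rewrite -ge0_integralZr//=.
  - apply: measurable_funTS; apply: emeasurable_funM => //.
    exact: (measurableT_comp mfs mT).
  - by move=> t _; rewrite mule_ge0// lee_fin mulr_ge0.
transitivity (\int[mu]_(s in `[0%R, pi]) \int[mu]_(t in `[0%R, pi]) D (s, t))%E.
  (* At the endpoints the Jacobian 2 sin t vanishes and the folded density need
     not. *)
  apply: eq_integral_itv_interior.
  - exact: (measurable_integral_snd mu _ mL L0).
  - exact: (measurable_integral_snd mu _ mD D0).
  move=> s s0; apply: eq_integral_itv_interior.
  - exact: (measurableT_comp mL (pair1_measurable (s : measurableTypeR R))).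
  - exact: (measurableT_comp mD (pair1_measurable (s : measurableTypeR R))).
  by move=> t t0; rewrite /L /D /f -!EFinM; congr (_%:E); exact: LUE_weight_circle_map.
have mDs s : measurable_fun setT (fun t => (folded_density (g \o circle_map) s t)%:E).
  exact: (measurableT_comp mD' (pair1_measurable (s : measurableTypeR R))).
have fd0 s t : (0 <= (folded_density (g \o circle_map) s t)%:E)%E.
  by rewrite lee_fin folded_density_ge0.
have DE s : (\int[mu]_(t in `[0%R, pi]) D (s, t) =
    c%:E * \int[mu]_(t in `[0%R, pi]) (folded_density (g \o circle_map) s t)%:E)%E.
  rewrite -ge0_integralZl//=; first exact: measurable_funTS (mDs s).
under eq_integral do rewrite DE.
rewrite ge0_integralZl//=; last 2 first.
- apply: measurable_funTS.
  by apply: (measurable_integral_snd mu _ mD') => // z; exact: fd0.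
- by move=> s _; exact: integral_ge0.
rewrite muleA -EFinM; congr (_%:E * _)%E.
have p0 : (pi : R) != 0 by rewrite gt_eqF.
by rewrite /c; move: p0; move: (@pi R) => p p0; field.
Qed.

End LUE.

(** * Polynomials as approximants, and the energy hypothesis *)

Section polynomials.
Context {R : realType}.
Local Notation mu := (@lebesgue_measure R).

Lemma smooth_horner (p : {poly R}) : smooth (horner p).
Proof.
move=> k x; suff -> : derive1n k (horner p) = horner (iter k (@deriv R) p).
  exact: derivable_horner.
by elim: k => [//|k IH]; rewrite derive1nS IH iterS derivE.
Qed.

Lemma Linfty04_horner (p : {poly R}) : Linfty04 (horner p).
Proof.
have mp : measurable_fun setT (horner p \_ `[0, 4]).
  apply/(measurable_restrictT _ (measurable_itv _)).
  by apply: measurable_funTS; apply: continuous_measurable_fun; exact: continuous_horner.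
have [B pB] := horner_bounded p 4.
have B0 : 0 <= B by apply: le_trans (pB 0 _); rewrite ?normr_ge0 ?normr0.
apply/andP; split; rewrite inE//=.
rewrite /finite_norm unlock; case: ifPn => // _.
apply: (@le_lt_trans _ _ B%:E); last exact: ltry.
apply/ess_supP; apply: nearW => x /=; rewrite lee_fin patchE.
case: ifPn => [|_]; last by rewrite normr0.
rewrite inE/= in_itv/= => /andP[x0 x4].
by apply: pB; rewrite ger0_norm.
Qed.

End polynomials.

Section weights.
Context {R : realType}.
Local Notation mu := (@lebesgue_measure R).
Local Notation RR := (measurableTypeR R * measurableTypeR R)%type.

(** Both are [(A ^+ 2 + B ^+ 2) / (8 * pi ^+ 2 * A * B)] with [A] and [B] the
    two square roots of [hyp_weight]; if [A] or [B] is zero, so are the two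
    weights, by the convention for division. *)
Lemma hyp_weightE (x y : R) : 0 <= x <= 4 -> 0 <= y <= 4 ->
  hyp_weight x y = LUE_weight x y.
Proof.
move=> /andP[x0 x4] /andP[y0 y4]; have pi0 := @pi_gt0 R.
have x4' : 0 <= 4 - x by rewrite subr_ge0.
have y4' : 0 <= 4 - y by rewrite subr_ge0.
rewrite /hyp_weight /LUE_weight !ger0_norm ?mulr_ge0//.
set A := Num.sqrt ((4 - x) * y); set B := Num.sqrt ((4 - y) * x).
have A2 : A ^+ 2 = (4 - x) * y by rewrite sqr_sqrtr// mulr_ge0.
have B2 : B ^+ 2 = (4 - y) * x by rewrite sqr_sqrtr// mulr_ge0.
have -> : 4 * pi ^+ 2 * Num.sqrt (4 - (x - 2) ^+ 2) * Num.sqrt (4 - (y - 2) ^+ 2) =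
    4 * pi ^+ 2 * (A * B).
  rewrite -!sqrtrM ?mulr_ge0// -mulrA -sqrtrM; last by nra.
  by congr (_ * Num.sqrt _); ring.
have -> : 4 - (x - 2) * (y - 2) = (A ^+ 2 + B ^+ 2) / 2 by rewrite A2 B2; field.
have [->|A0] := eqVneq A 0; first by rewrite !(mul0r, invr0, mulr0, addr0).
have [->|B0] := eqVneq B 0; first by rewrite !(mul0r, invr0, mulr0, addr0).
have p0 : (pi : R) != 0 by rewrite gt_eqF.
move: p0; move: (@pi R) => p p0.
by field; rewrite A0 B0 p0.
Qed.

Lemma hyp_weight_ge0 (x y : R) : 0 <= hyp_weight x y.
Proof.
apply: mulr_ge0; first by rewrite divr_ge0// mulr_ge0// exprn_ge0// pi_ge0.
by rewrite addr_ge0 ?divr_ge0 ?sqrtr_ge0.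
Qed.

Lemma measurable_hyp_weight :
  measurable_fun [set: RR] (fun z : RR => hyp_weight z.1 z.2).
Proof.
have msq (u v : RR -> R) : measurable_fun setT u -> measurable_fun setT v ->
    measurable_fun setT (fun z => Num.sqrt `|(4 - u z) * v z|).
  move=> mu_ mv; apply: measurableT_comp; first exact: measurable_sqrt.
  apply: measurableT_comp => //; apply: measurable_funM => //.
  exact: measurable_funB.
apply: measurable_funM => //.
by apply: measurable_funD; apply: measurable_div; exact: msq.
Qed.

Lemma eq_V_LUE (f g : R -> R) : (forall x, 0 <= x <= 4 -> f x = g x) ->
  V_LUE f = V_LUE g.
Proof.
move=> fg; apply: eq_integral => y /[!inE]/=; rewrite in_itv/= => y4.
apply: eq_integral => x /[!inE]/=; rewrite in_itv/= => x4.
by rewrite /diffquot2 !fg.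
Qed.

Lemma eq_hyp_integral (e : R) (f g : R -> R) :
  (forall x, 0 <= x <= 4 + e -> f x = g x) ->
  hyp_integral e f = hyp_integral e g.
Proof.
move=> fg; apply: eq_integral => y /[!inE]/=; rewrite in_itv/= => y4.
apply: eq_integral => x /[!inE]/=; rewrite in_itv/= => x4.
by rewrite /diffquot2 !fg.
Qed.

Lemma V_LUE_le_hyp_integral (e : R) (f : R -> R) : 0 <= e ->
  measurable_fun setT f -> (V_LUE f <= hyp_integral e f)%E.
Proof.
move=> e0 mf.
pose F (z : RR) := (diffquot2 f z.2 z.1 * hyp_weight z.2 z.1)%:E.
have mF : measurable_fun [set: RR] F.
  apply/measurable_EFinP; apply: measurable_funM.
    exact: (measurable_swap (measurable_diffquot2 mf)).
  exact: (measurable_swap measurable_hyp_weight).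
have F0 z : (0 <= F z)%E.
  by rewrite lee_fin mulr_ge0 ?diffquot2_ge0// hyp_weight_ge0.
have sub : `[0, 4] `<=` (`[0, 4 + e] : set R).
  move=> x /=; rewrite !in_itv/= => /andP[-> x4]/=.
  by rewrite (le_trans x4)// lerDl.
have -> : V_LUE f =
    (\int[mu]_(y in `[0%R, 4%R]) \int[mu]_(x in `[0%R, 4%R]) F (y, x))%E.
  apply: eq_integral => y /[!inE]/=; rewrite in_itv/= => y4.
  apply: eq_integral => x /[!inE]/=; rewrite in_itv/= => x4.
  by rewrite /F/= hyp_weightE.
have mFy y : measurable_fun setT (fun x => F (y, x)).
  exact: (measurableT_comp mF (pair1_measurable (y : measurableTypeR R))).
have mI (D : set R) (mD : measurable D) := measurable_integral_snd mu mD mF F0.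
apply: (@le_trans _ _ (\int[mu]_(y in `[0%R, 4%R])
    \int[mu]_(x in `[0%R, (4 + e)%R]) F (y, x))%E).
  apply: ge0_le_integral => //.
  - by move=> y _; exact: integral_ge0.
  - by apply: measurable_funTS; exact: mI.
  - by apply: measurable_funTS; exact: mI.
  - move=> y _; apply: ge0_subset_integral => //.
    exact: measurable_funTS (mFy y).
apply: ge0_subset_integral => //.
- by apply: measurable_funTS; exact: mI.
- by move=> y _; exact: integral_ge0.
Qed.

End weights.

Theorem lemma1p2 (R : realType) (f : R -> R)
  (mf : measurable_fun (`[0, +oo[ : set R) f)
  (hf : exists2 eps0 : R, 0 < eps0 & (hyp_integral eps0 f < +oo)%E) :
  exists fn : nat -> R -> R,
    (forall n : nat, smooth (fn n) /\ Linfty04 (fn n)) /\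
    (forall eps : R, 0 < eps ->
       exists N : nat, forall n : nat, (N < n)%N ->
         (V_LUE (f \- fn n)%R < eps%:E)%E).
Proof.
have [e e0 fe] := hf.
(* [f] is only measurable on [0, +oo[, and only its values on [0, 4 + e]
   matter, so it is cut off to a function measurable on the line. *)
pose g := f \_ `[0, +oo[.
have mg : measurable_fun setT g.
  by apply/(measurable_restrictT _ (measurable_itv _)).
have fg (x : R) : 0 <= x -> f x = g x.
  by move=> x0; rewrite /g patchE mem_set//= in_itv/= x0.
have pi0 := @pi_gt0 R.
have Vg : (V_LUE g < +oo)%E.
  apply: le_lt_trans fe; rewrite (@eq_hyp_integral _ _ f g).
    exact: V_LUE_le_hyp_integral (ltW e0) mg.
  by move=> x /andP[x0 _]; exact: fg.
pose h := g \o circle_map.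
pose c : R := 32 * pi ^+ 2.
have c0 : 0 < c by rewrite mulr_gt0// exprn_gt0.
have mh : measurable_fun setT h.
  by apply: measurableT_comp => //; exact: measurable_circle_map.
have Eh : (circle_energy h < +oo)%E.
  move: Vg; rewrite V_LUE_circle_energy//; apply: contraTT.
  rewrite -!leNgt !leye_eq => /eqP ->.
  by rewrite gt0_muley// lte_fin invr_gt0.
have [||p pE] := cosine_polynomial_approximation mh _ _ Eh.
- by move=> x; rewrite /h /= /circle_map cosD2pi.
- by move=> x; rewrite /h /= /circle_map cosN.
(* cos t = (x - 2) / 2 when x = 2 + 2 cos t *)
pose q n : {poly R} := p n \Po (2^-1 *: ('X - 2%:P)).
exists (fun n => horner (q n)); split.
  by move=> n; split; [exact: smooth_horner|exact: Linfty04_horner].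
have VE n : V_LUE (f \- horner (q n))%R =
    (c^-1%:E * circle_energy (fun x => h x - (p n).[cos x])%R)%E.
  rewrite (@eq_V_LUE _ _ (g \- horner (q n))); last first.
    by move=> x /andP[x0 _] /=; rewrite fg.
  rewrite V_LUE_circle_energy; last first.
    apply: measurable_funB => //; apply: continuous_measurable_fun.
    exact: continuous_horner.
  congr (_ * circle_energy _)%E; apply/funext => x /=.
  rewrite /q horner_comp !hornerE /circle_map; congr (_ - (p n).[_]).
  by field.
move=> eps eps0; have ce0 : 0 < c * eps by rewrite mulr_gt0.
have /fine_cvgP[fin_p cvg_p] := pE.
have small := cvgr_lt _ cvg_p _ ce0.
have [N _ HN] : \forall n \near \oo, (V_LUE (f \- horner (q n))%R < eps%:E)%E.
  near=> n; rewrite VE.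
  have fn : circle_energy (fun x => h x - (p n).[cos x])%R \is a fin_num.
    by near: n; exact: fin_p.
  rewrite -(fineK fn) -EFinM lte_fin ltr_pdivrMl//.
  by near: n; exact: small.
by exists N => n /ltnW; exact: HN.
Unshelve. all: by end_near.
Qed.
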